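(* Let $1\le k\le n$ and let $E_1,\dots,E_k$ be infinite-dimensional $\mathcal{L}_\infty$-spaces over $\mathbb{K}$. Then there is no infinite-dimensional Banach space $F$ over $\mathbb{K}$ such that, for all Banach spaces $E_{k+1},\dots,E_n$ over $\mathbb{K}$, $$\mathcal{L}(E_1,\dots,E_n;F)=\mathcal{L}_{as(1;q_1,\dots,q_n)}(E_1,\dots,E_n;F),$$ where $q_1=\dots=q_k=2$ and $q_{k+1}=\dots=q_n=1$.
   Context: The scalar field $\mathbb{K}$ is $\mathbb{R}$ or $\mathbb{C}$. $\mathcal{L}(E_1,\dots,E_n;F)$ is the space of bounded $n$-linear mappings $E_1\times\dots\times E_n\to F$. For $p\ge1$, $l_p(E)$ is the space of sequences $(x_j)$ in $E$ with $\sum_j\|x_j\|^p<\infty$, and $l_p^w(E)$ is the space of sequences $(x_j)$ in $E$ with $(\varphi(x_j))_j\in l_p$ for every bounded linear functional $\varphi$ on $E$. A mapping $T\in\mathcal{L}(E_1,\dots,E_n;F)$ is absolutely $(p;q_1,\dots,q_n)$-summing if $(T(x_j^{(1)},\dots,x_j^{(n)}))_{j=1}^\infty\in l_p(F)$ whenever $(x_j^{(i)})_{j=1}^\infty\in l_{q_i}^w(E_i)$ for $i=1,\dots,n$; the space of all such mappings is denoted $\mathcal{L}_{as(p;q_1,\dots,q_n)}(E_1,\dots,E_n;F)$. A Banach space $E$ is an $\mathcal{L}_\infty$-space (Lindenstrauss–Pełczyński) if there is $\lambda\ge1$ such that every finite-dimensional subspace of $E$ is contained in a finite-dimensional subspace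 $G\subseteq E$ whose Banach–Mazur distance to $l_\infty^{\dim G}$ is at most $\lambda$. *)

(* Defs.v *)
From mathcomp Require Import all_boot all_order all_algebra.
From mathcomp Require Import all_classical all_reals all_analysis.
From mathcomp Require Import complex.

Set Implicit Arguments.
Unset Strict Implicit.
Unset Printing Implicit Defensive.

Import Order.TTheory GRing.Theory Num.Theory.
Import numFieldNormedType.Exports.

Local Open Scope classical_set_scope.
Local Open Scope ring_scope.

Variant scalar_kind := RealScalars | ComplexScalars.

Definition scalars (R : realType) (s : scalar_kind) : numFieldType :=
  match s with
  | RealScalars => R : numFieldType
  | ComplexScalars => R[i] : numFieldType
  end.

(* A [normedModType K] has a [K]-valued norm. Its values are nonnegative, hence
   real; [rnorm] is the norm seen as an element of [R]. *)
Definition real_value (R : realType) (s : scalar_kind) : scalars R s -> R :=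
  match s with
  | RealScalars => fun z => z
  | ComplexScalars => fun z => complex.Re z
  end.

Definition rnorm (R : realType) (s : scalar_kind)
    (E : normedModType (scalars R s)) (x : E) : R :=
  real_value `|x|.

Definition lin_indep (K : numFieldType) (E : normedModType K) (m : nat)
    (e : 'I_m -> E) : Prop :=
  forall c : 'I_m -> K, \sum_i c i *: e i = 0 -> forall i, c i = 0.

Definition lin_span (K : numFieldType) (E : normedModType K) (m : nat)
    (e : 'I_m -> E) : set E :=
  [set x | exists c : 'I_m -> K, x = \sum_i c i *: e i].

(* [V] is a linear subspace of dimension [m]. *)
Definition has_dim (K : numFieldType) (E : normedModType K)
    (V : set E) (m : nat) : Prop :=
  exists2 e : 'I_m -> E, lin_indep e & V = lin_span e.

Definition findim_subspace (K : numFieldType) (E : normedModType K)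
    (V : set E) : Prop :=
  exists m : nat, has_dim V m.

Definition infinite_dimensional (K : numFieldType) (E : normedModType K) : Prop :=
  ~ findim_subspace [set: E].

Definition linear_on (K : numFieldType) (X Y : normedModType K)
    (A : set X) (f : X -> Y) : Prop :=
  forall (a : K) (x y : X), A x -> A y -> f (a *: x + y) = a *: f x + f y.

Definition opnorm_on (R : realType) (s : scalar_kind)
    (X Y : normedModType (scalars R s)) (A : set X) (f : X -> Y) : \bar R :=
  ereal_sup [set (rnorm (f x))%:E | x in [set x | A x /\ rnorm x <= 1]].

(* Infimum of ||f|| ||f^-1|| over the linear isomorphisms f of the subspace [A]
   of [X] onto the subspace [B] of [Y]; the inverse is given by [g]. *)
Definition banach_mazur (R : realType) (s : scalar_kind)
    (X Y : normedModType (scalars R s)) (A : set X) (B : set Y) : \bar R :=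
  ereal_inf [set d | exists (f : X -> Y) (g : Y -> X),
    [/\ linear_on A f, set_bij A B f, (forall x, A x -> g (f x) = x)
      & d = (opnorm_on A f * opnorm_on B g)%E]].

(* The norm of ['rV[K]_m] is the sup norm, so this space is l_oo^m. *)
Definition script_Linfty_space (R : realType) (s : scalar_kind)
    (E : normedModType (scalars R s)) : Prop :=
  exists2 lambda : R, 1 <= lambda &
    forall V : set E, findim_subspace V ->
      exists (G : set E) (m : nat),
        [/\ has_dim G m, V `<=` G
          & (banach_mazur G [set: 'rV[scalars R s]_m] <= lambda%:E)%E].

Definition multilinear (K : numFieldType) (I : finType)
    (E : I -> completeNormedModType K) (F : completeNormedModType K)
    (T : (forall i, E i) -> F) : Prop :=
  forall (i : I) (x : forall j, E j) (a : K) (u v : E i),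
    T (dfwith x i (a *: u + v)) = a *: T (dfwith x i u) + T (dfwith x i v).

Definition bounded_multilinear (K : numFieldType) (I : finType)
    (E : I -> completeNormedModType K) (F : completeNormedModType K) :
    set ((forall i, E i) -> F) :=
  [set T | multilinear T /\
    exists M : K, forall x, `|T x| <= M * \prod_i `|x i|].

Arguments bounded_multilinear {K I} E F.

Definition lp_seq (R : realType) (s : scalar_kind)
    (E : normedModType (scalars R s)) (p : R) : set (nat -> E) :=
  [set x | (\sum_(0 <= j <oo) (rnorm (x j) `^ p)%:E < +oo)%E].

Definition weak_lp_seq (R : realType) (s : scalar_kind)
    (E : normedModType (scalars R s)) (p : R) : set (nat -> E) :=
  [set x | forall phi : {linear E -> (scalars R s)^o},
    (exists M : scalars R s, forall y, `|phi y| <= M * `|y|) ->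
    lp_seq p (fun j => phi (x j))].

Definition abs_summing (R : realType) (s : scalar_kind) (I : finType)
    (p : R) (q : I -> R)
    (E : I -> completeNormedModType (scalars R s))
    (F : completeNormedModType (scalars R s)) :
    set ((forall i, E i) -> F) :=
  [set T | bounded_multilinear E F T /\
    forall x : forall i, nat -> E i,
      (forall i, weak_lp_seq (q i) (x i)) ->
      lp_seq p (fun j => T (fun i => x i j))].

Arguments abs_summing {R s I} p q E F.

(* The family E_1, ..., E_k, E_(k+1), ..., E_n, where [G] lists the last
   n - k members. *)
Definition join_family (B : Type) (n k : nat) (hkn : (k <= n)%N)
    (E : 'I_k -> B) (G : 'I_(n - k) -> B) (i : 'I_n) : B :=
  match fintype.split (cast_ord (esym (subnKC hkn)) i) with
  | inl a => E a
  | inr b => G b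
  end.

(* Main.v *)
Require Import Defs.
From HB Require Import structures.
From mathcomp Require Import all_boot all_order all_algebra.
From mathcomp Require Import all_classical all_reals all_analysis.
From mathcomp Require Import perm complex zify ring lra.

Set Implicit Arguments.
Unset Strict Implicit.
Unset Printing Implicit Defensive.

Import Order.TTheory GRing.Theory Num.Theory.
Import numFieldNormedType.Exports.

Local Open Scope classical_set_scope.
Local Open Scope ring_scope.

(** The remaining spaces are free, so all of them may be taken equal to E_1, and
    the task is to find one bounded multilinear map on infinite-dimensional
    L_oo-spaces X_i with values in F, and weakly summable sequences in the
    X_i, whose images are not absolutely summable. A weakly 1-summable sequence is
    weakly 2-summable, so the exponents 1 and 2 need no separate treatment.

    An L_oo-space contains the unit vectors x_1, ..., x_N of uniform copies of l_oo^N,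
    together with biorthogonal functionals p_j on the whole space of norm at most
    1, and the weak-1-norm of the x_j does not depend on N
    ([script_Linfty_cubes], where Hahn-Banach extends the coordinates). Given
    vectors y_j of F, the diagonal map T(z_1, z_2, ...) = sum_j (prod_i p_j(z_i)) y_j
    sends the j-th unit vectors to y_j, and its norm is at most the
    weak-1-norm of the y_j. By the Dvoretzky-Rogers lemma an infinite-dimensional F
    contains finite families of weak-1-norm 1 whose norms have an arbitrarily large
    sum ([large_unconditional_family]). It is proved here by a determinant: among
    the maps of norm at most 1 from 2n-dimensional Euclidean space to F, one with
    nearly maximal determinant cannot be small on any subspace of dimension
    greater than n, since it could be enlarged there ([dvoretzky_rogers]).

    No single map T is produced by this, only one for each size. A gliding hump
    with suitably chosen signs ([gliding_hump]) adds the maps of different sizes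
    up to one T that is large on all blocks at once, and concatenating the blocks
    with geometric weights gives the sequences ([non_summing_multilinear]). *)

(** * Real-valued norms over real or complex scalars *)

(** The embedding of the reals into the scalar field. Inequalities between the
    scalar-valued norms are pulled back along it to inequalities between reals,
    where suprema and linear arithmetic are available. *)
Definition ofr (R : realType) (s : scalar_kind) : R -> scalars R s :=
  match s return R -> scalars R s with
  | RealScalars => fun r => r
  | ComplexScalars => fun r => r%:C%C
  end.
Arguments ofr {R} s r.

Section Scalars.
Context (R : realType) (s : scalar_kind).
Local Notation K := (scalars R s).
Implicit Types (a b : R).

Lemma ofrK : cancel (ofr s) (@real_value R s).
Proof. by case: s. Qed.

Lemma ofrD a b : ofr s (a + b) = ofr s a + ofr s b.
Proof. by case: s => //=; rewrite rmorphD. Qed.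

Lemma ofrM a b : ofr s (a * b) = ofr s a * ofr s b.
Proof. by case: s => //=; rewrite rmorphM. Qed.

Lemma ofrN a : ofr s (- a) = - ofr s a.
Proof. by case: s => //=; rewrite rmorphN. Qed.

Lemma ofr0 : ofr s 0 = 0 :> K.
Proof. by case: s. Qed.

Lemma ofr1 : ofr s 1 = 1 :> K.
Proof. by case: s. Qed.

Lemma ofr_le a b : (ofr s a <= ofr s b) = (a <= b).
Proof. by case: s => //=; rewrite lecR. Qed.

Lemma ofr_lt a b : (ofr s a < ofr s b) = (a < b).
Proof. by case: s => //=; rewrite ltcR. Qed.

Lemma ofr_norm a : `|ofr s a| = ofr s `|a|.
Proof. by case: s => //=; rewrite normc_def /= expr0n addr0 sqrtr_sqr. Qed.

Lemma real_value_normK (z : K) : ofr s (real_value `|z|) = `|z|.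
Proof. by move: z; case: s. Qed.

Lemma real_value_ge0 (z : K) : 0 <= z -> ofr s (real_value z) = z.
Proof. by move=> z0; rewrite -[z]ger0_norm // real_value_normK. Qed.

Section Norm.
Context (E : normedModType K).
Implicit Types (x y : E).

Lemma normE x : `|x| = ofr s (rnorm x).
Proof. by rewrite /rnorm real_value_ge0. Qed.

Lemma rnorm_le x (r : R) : (`|x| <= ofr s r) = (rnorm x <= r).
Proof. by rewrite normE ofr_le. Qed.

Lemma rnorm_ge0 x : 0 <= rnorm x.
Proof. by rewrite -(ofr_le) ofr0 -normE. Qed.

Lemma rnormD x y : rnorm (x + y) <= rnorm x + rnorm y.
Proof. by rewrite -ofr_le ofrD -!normE ler_normD. Qed.

Lemma rnorm0 : rnorm (0 : E) = 0.
Proof. by rewrite /rnorm normr0 -ofr0 ofrK. Qed.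

Lemma rnormN x : rnorm (- x) = rnorm x.
Proof. by rewrite /rnorm normrN. Qed.

Lemma rnormBC x y : rnorm (x - y) = rnorm (y - x).
Proof. by rewrite -rnormN opprB. Qed.

Lemma rnorm_eq0 x : rnorm x = 0 -> x = 0.
Proof. by move=> x0; apply/eqP; rewrite -normr_eq0 normE x0 ofr0. Qed.

Lemma rnorm_sum (I : Type) (r : seq I) (P : pred I) (f : I -> E) :
  rnorm (\sum_(i <- r | P i) f i) <= \sum_(i <- r | P i) rnorm (f i).
Proof.
elim/big_rec2: _ => [|i a b _ h]; first by rewrite rnorm0.
by apply: (le_trans (rnormD _ _)); rewrite lerD2l.
Qed.
End Norm.

(** The modulus is the norm of the regular module, so every lemma on [rnorm]
    applies to scalars as well. *)
Definition rabs (z : K) : R := @rnorm R s (K^o) z.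

Lemma rabsE (z : K) : `|z| = ofr s (rabs z).
Proof. exact: (@normE (K^o)). Qed.

Lemma rnormZ (E : normedModType K) (a : K) (x : E) :
  rnorm (a *: x) = rabs a * rnorm x.
Proof.
by apply: (can_inj ofrK); rewrite ofrM -normE normrZ rabsE normE.
Qed.

Lemma rabsM (a b : K) : rabs (a * b) = rabs a * rabs b.
Proof. exact: (@rnormZ (K^o)). Qed.

Lemma rabs_ofr (r : R) : rabs (ofr s r) = `|r|.
Proof. by apply: (can_inj ofrK); rewrite -rabsE ofr_norm. Qed.

Lemma rabs0 : rabs 0 = 0.
Proof. exact: (@rnorm0 (K^o)). Qed.

Lemma rabs1 : rabs 1 = 1.
Proof. by rewrite -ofr1 rabs_ofr normr1. Qed.

Lemma rabs_ge0 (a : K) : 0 <= rabs a.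
Proof. exact: (@rnorm_ge0 (K^o)). Qed.

Lemma rabs_prod (I : Type) (r : seq I) (P : pred I) (f : I -> K) :
  rabs (\prod_(i <- r | P i) f i) = \prod_(i <- r | P i) rabs (f i).
Proof. by apply: (big_morph rabs rabsM rabs1). Qed.

Lemma rnormZr (E : normedModType K) (r : R) (x : E) :
  rnorm (ofr s r *: x) = `|r| * rnorm x.
Proof. by rewrite rnormZ rabs_ofr. Qed.

End Scalars.

(** * Hahn-Banach extension and biorthogonal systems *)

(** Partial extensions are encoded by their graphs, the linear subspaces of
    [V * R] that lie below [p]: Zorn's lemma then speaks of inclusion only, and
    such a graph is single-valued because [p 0 = 0]. The graph of [f] is not a
    subset of the union of the empty chain, hence the extra disjunct in [P]. *)
Lemma hahn_banach_sublinear (R : realType) (V : lmodType R) (p : V -> R)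
    (A : set V) (f : V -> R)
    (pD : forall x y, p (x + y) <= p x + p y)
    (pZ : forall t x, 0 <= t -> p (t *: x) = t * p x)
    (A0 : A 0) (AL : forall a x y, A x -> A y -> A (a *: x + y))
    (fL : forall a x y, A x -> A y -> f (a *: x + y) = a * f x + f y)
    (fp : forall x, A x -> f x <= p x) :
  exists phi : V -> R,
    [/\ forall a x y, phi (a *: x + y) = a * phi x + phi y,
        forall x, A x -> phi x = f x & forall x, phi x <= p x].
Proof.
pose good (G : set (V * R)) :=
  [/\ forall x, A x -> G (x, f x),
      forall a x r y t, G (x, r) -> G (y, t) -> G (a *: x + y, a * r + t)
    & forall x r, G (x, r) -> r <= p x].
pose P (G : set (V * R)) := G = set0 \/ good G.
have goodf : good [set z | A z.1 /\ z.2 = f z.1].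
  split=> [x Ax //|a x r y t /= [Ax ->] [Ay ->]|x r /= [Ax ->]].
  - by split; [exact: AL | rewrite fL].
  - exact: fp.
have [|G [PG Gmax]] := @Zorn_bigcup _ P.
  move=> C CP Ctot.
  have [[X [CX [z Xz]]]|noX] := pselect (exists X, C X /\ X !=set0); last first.
    left; rewrite -subset0 => z [X CX Xz].
    by case: noX; exists X; split => //; exists z.
  right; split.
  - move=> x Ax; exists X => //.
    by case: (CP _ CX) => [X0|[+ _ _]]; [rewrite X0 in Xz | apply].
  - move=> a x r y t [Y CY Yx] [Z CZ Zy].
    have [YZ|ZY] := Ctot _ _ CY CZ.
    + exists Z => //; case: (CP _ CZ) => [Z0|[_ + _]].
        by rewrite Z0 in Zy.
      by apply => //; apply: YZ.
    + exists Y => //; case: (CP _ CY) => [Y0|[_ + _]].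
        by rewrite Y0 in Yx.
      by apply => //; apply: ZY.
  - move=> x r [Y CY Yx]; case: (CP _ CY) => [Y0|[_ _]].
      by rewrite Y0 in Yx.
    exact.
have [Gf Glin Gp] : good G.
  case: PG => // G0; exfalso.
  apply: (Gmax [set z | A z.1 /\ z.2 = f z.1]); last by right.
  rewrite G0; split; first exact: sub0set.
  by move=> /(_ (0, f 0)); apply.
have p0 : p 0 = 0 by rewrite -(scale0r 0) pZ // mul0r.
have G0 : G (0, 0).
  have /= := Glin (-1) _ _ _ _ (Gf 0 A0) (Gf 0 A0).
  by rewrite scaler0 addr0 mulN1r addNr.
have GZ a x r : G (x, r) -> G (a *: x, a * r).
  by move=> Gx; have := Glin a _ _ _ _ Gx G0; rewrite !addr0.
have GD x r y t : G (x, r) -> G (y, t) -> G (x + y, r + t).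
  by move=> Gx Gy; have := Glin 1 _ _ _ _ Gx Gy; rewrite scale1r mul1r.
have Guniq x r t : G (x, r) -> G (x, t) -> r = t.
  move=> Gr Gt; apply/eqP; rewrite eq_le -subr_le0 -[X in _ && X]subr_le0 -!p0.
  have H u w : G (x, u) -> G (x, w) -> u - w <= p 0.
    move=> Gu Gw; have := Glin (-1) _ _ _ _ Gw Gu.
    by rewrite scaleN1r addNr mulN1r addrC => /Gp.
  by rewrite !H.
have Gtot v : exists r, G (v, r).
  apply: contrapT => nov.
  (* The value [c] at the new vector must lie between all r - p (x - v) and
     all p (y + v) - t; subadditivity says that these two families are ordered. *)
  pose S := [set z.2 - p (z.1 - v) | z in G].
  have Sub x r y t : G (x, r) -> G (y, t) -> r - p (x - v) <= p (y + v) - t.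
    move=> Gx Gy; rewrite lerBrDr addrAC lerBlDr.
    apply: (le_trans (Gp _ _ (GD _ _ _ _ Gx Gy))).
    have -> : x + y = (y + v) + (x - v) by rewrite addrACA subrr addr0 addrC.
    exact: pD.
  have hS : has_sup S.
    split; first by exists (0 - p (0 - v)), (0, 0).
    exists (p (0 + v) - 0) => _ [[x r] Gx] /= <-; exact: Sub.
  pose c := sup S.
  have c1 x r : G (x, r) -> r - c <= p (x - v).
    move=> Gx; rewrite lerBlDr addrC -lerBlDr.
    by apply: sup_upper_bound => //; exists (x, r).
  have c2 x r : G (x, r) -> r + c <= p (x + v).
    move=> Gx; rewrite addrC -lerBrDr; apply: ge_sup; first by case: hS.
    by move=> _ [[y t] Gy] /= <-; apply: Sub.
  pose G' := [set z : V * R | exists x r a,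
    [/\ G (x, r), z.1 = x + a *: v & z.2 = r + a * c]].
  apply: (Gmax G').
    split=> [[x r] Gx /=|sub].
      by exists x, r, 0; split => //=; rewrite ?scale0r ?mul0r addr0.
    apply: nov; exists c; apply: sub.
    by exists 0, 0, 1; split => //=; rewrite ?scale1r ?mul1r add0r.
  right; split.
  - move=> x Ax; exists x, (f x), 0; split => //=; first exact: Gf.
      by rewrite scale0r addr0.
    by rewrite mul0r addr0.
  - move=> a x r y t [x1 [r1 [a1 [G1 /= -> ->]]]] [y1 [t1 [b1 [H1 /= -> ->]]]].
    exists (a *: x1 + y1), (a * r1 + t1), (a * a1 + b1); split => /=.
    + exact: Glin.
    + by rewrite scalerDr scalerDl scalerA addrACA.
    + by ring.
  - move=> x r [x1 [r1 [a [G1 /= -> ->]]]].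
    have [a0|a0|->] := ltgtP a 0.
    + have b0 : 0 < - a by rewrite oppr_gt0.
      have := c1 _ _ (GZ (- a)^-1 _ _ G1).
      rewrite -(ler_pM2l b0) -(pZ _ _ (ltW b0)) scalerBr scalerA mulrBr mulrA.
      by rewrite mulfV ?gt_eqF // scale1r mul1r scaleNr mulNr !opprK.
    + have := c2 _ _ (GZ a^-1 _ _ G1).
      rewrite -(ler_pM2l a0) -(pZ _ _ (ltW a0)) scalerDr scalerA mulrDr mulrA.
      by rewrite mulfV ?gt_eqF // scale1r mul1r.
    + by rewrite mul0r scale0r !addr0; exact: Gp.
have [phi phiP] := choice Gtot.
exists phi; split=> [a x y|x Ax|x].
- by apply: (Guniq (a *: x + y)) => //; apply: Glin.
- by apply: (Guniq x) => //; apply: Gf.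
- exact: Gp.
Qed.

(** The real vector space underlying a normed space over the scalars; a copy of
    the type is needed to carry the second module structure. *)
Definition realify (R : realType) (s : scalar_kind)
  (E : normedModType (scalars R s)) : Type := E.

Section Realify.
Context (R : realType) (s : scalar_kind) (E : normedModType (scalars R s)).

HB.instance Definition _ := GRing.Zmodule.copy (realify E) E.

Definition real_scale (r : R) (x : realify E) : realify E :=
  ofr s r *: (x : E).

Fact real_scaleA a b x : real_scale a (real_scale b x) = real_scale (a * b) x.
Proof. by rewrite /real_scale scalerA ofrM. Qed.

Fact real_scale1 : left_id 1 real_scale.
Proof. by move=> x; rewrite /real_scale ofr1 scale1r. Qed.

Fact real_scaleDr : right_distributive real_scale +%R.
Proof. by move=> a x y; rewrite /real_scale -scalerDr. Qed.

Fact real_scaleDl x : {morph real_scale^~ x : a b / a + b}.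
Proof. by move=> a b; rewrite /real_scale ofrD scalerDl. Qed.

HB.instance Definition _ := GRing.Zmodule_isLmodule.Build R (realify E)
  real_scaleA real_scale1 real_scaleDr real_scaleDl.

Lemma realifyZ (r : R) (x : E) : r *: (x : realify E) = ofr s r *: x :> E.
Proof. by []. Qed.

End Realify.

(** A scalar is a real combination of 1 and of a fixed [j], the imaginary unit
    or 0; real estimates pass to scalar coefficients at the price of a factor 2. *)
Lemma scalar_split (R : realType) (s : scalar_kind) :
  exists2 j : scalars R s, rabs j <= 1 &
    forall z : scalars R s, exists a b : R,
      [/\ z = ofr s a + j * ofr s b, `|a| <= rabs z & `|b| <= rabs z].
Proof.
case: s.
  exists 0; first by rewrite rabs0.
  by move=> z; exists z, 0; rewrite mul0r addr0 normr0 rabs_ge0.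
exists ('i%C : R[i]).
  rewrite -(@ofr_le R ComplexScalars) -rabsE ofr1 normc_def /=.
  by rewrite expr0n expr1n add0r sqrtr1.
move=> z; exists (complex.Re z), (complex.Im z); split.
- by case: z => a b; simpc.
- rewrite -(@ofr_le R ComplexScalars) -rabsE -ofr_norm.
  case: z => a b /=; rewrite !normc_def /= lecR expr0n addr0.
  by rewrite ler_wsqrtr // lerDl sqr_ge0.
- rewrite -(@ofr_le R ComplexScalars) -rabsE -ofr_norm.
  case: z => a b /=; rewrite !normc_def /= lecR expr0n addr0.
  by rewrite ler_wsqrtr // lerDr sqr_ge0.
Qed.

Definition bounded_functional (R : realType) (s : scalar_kind)
    (E : normedModType (scalars R s)) (f : E -> scalars R s) (M : R) : Prop :=
  (forall a x y, f (a *: x + y) = a * f x + f y) /\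
  (forall x, rabs (f x) <= M * rnorm x).

Section BoundedFunctional.
Context (R : realType) (s : scalar_kind) (E : normedModType (scalars R s)).
Context (f : E -> scalars R s) (M : R) (hf : bounded_functional f M).

Lemma bfunD x y : f (x + y) = f x + f y.
Proof. by have := hf.1 1 x y; rewrite scale1r mul1r. Qed.

Lemma bfun0 : f 0 = 0.
Proof. by apply: (@addrI _ (f 0)); rewrite -bfunD !addr0. Qed.

Lemma bfunZ a x : f (a *: x) = a * f x.
Proof. by have := hf.1 a x 0; rewrite bfun0 !addr0. Qed.

Lemma bfunB x y : f (x - y) = f x - f y.
Proof. by rewrite -scaleN1r bfunD bfunZ mulN1r. Qed.

Lemma bfun_sum (I : Type) (r : seq I) (P : pred I) (g : I -> E) :
  f (\sum_(i <- r | P i) g i) = \sum_(i <- r | P i) f (g i).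
Proof. exact: (big_morph f bfunD bfun0). Qed.

End BoundedFunctional.

Lemma real_value_le_rabs (R : realType) (s : scalar_kind) (z : scalars R s) :
  real_value z <= rabs z.
Proof.
rewrite -(@ofr_le R s) -rabsE.
case: s z => [z|z]; first exact: ler_norm.
apply: (@le_trans _ _ `|(complex.Re z)%:C%C|).
  by rewrite (@ofr_norm R ComplexScalars) /= lecR ler_norm.
case: z => a b; rewrite !normc_def /= lecR expr0n addr0.
by rewrite ler_wsqrtr // lerDl sqr_ge0.
Qed.

Lemma real_value_norm_le (R : realType) (s : scalar_kind) (z : scalars R s) :
  `|real_value z| <= rabs z.
Proof.
have rvN : real_value (- z) = - real_value z by case: s z => // -[].
rewrite ler_norml real_value_le_rabs andbT lerNl -rvN.
by apply: (le_trans (real_value_le_rabs _)); rewrite /rabs rnormN.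
Qed.

Lemma real_value_real_linear (R : realType) (s : scalar_kind) (a : R)
    (z w : scalars R s) :
  real_value (ofr s a * z + w) = a * real_value z + real_value w.
Proof. by case: s z w => // -[z1 z2] [w1 w2] /=; rewrite mul0r subr0. Qed.

Lemma imaginary_scale (K : comNzRingType) (V : lmodType K) (i : K)
    (ii : i * i = -1) (a b : K) (x y : V) :
  (a + b * i) *: x + y = a *: x + (b *: (i *: x) + y) /\
  i *: (a *: x + (b *: (i *: x) + y)) =
    a *: (i *: x) + ((- b) *: x + i *: y).
Proof.
split; first by rewrite scalerDl -scalerA addrA.
have ibi : i * b * i = - b by rewrite mulrAC ii mulN1r.
by rewrite !scalerDr !scalerA [i * a]mulrC ibi.
Qed.

(** The real part of [f] extends by the sublinear version. Over the complex
    numbers the extension [u] yields the complex functional u x - i u (i x), which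
    restricts to [f]; bounding its two terms separately gives the factor 2, which
    is harmless here. *)
Lemma hahn_banach_extension (R : realType) (s : scalar_kind)
    (E : normedModType (scalars R s)) (A : set E) (f : E -> scalars R s) (M : R)
    (M0 : 0 <= M) (A0 : A 0)
    (AL : forall a x y, A x -> A y -> A (a *: x + y))
    (fL : forall a x y, A x -> A y -> f (a *: x + y) = a * f x + f y)
    (fM : forall x, A x -> rabs (f x) <= M * rnorm x) :
  exists2 phi : E -> scalars R s,
    bounded_functional phi (2 * M) & forall x, A x -> phi x = f x.
Proof.
have [||||||u [uL uf up]] := @hahn_banach_sublinear R (realify E)
    (fun x => M * rnorm (x : E)) A (fun x => real_value (f x)).
- by move=> x y; rewrite -mulrDr ler_wpM2l ?rnormD.
- by move=> t x t0; rewrite realifyZ rnormZr ger0_norm // mulrCA.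
- exact: A0.
- by move=> a x y; apply: AL.
- by move=> a x y Ax Ay; rewrite -real_value_real_linear -fL.
- by move=> x Ax; apply: (le_trans (real_value_le_rabs _)); exact: fM.
have u0 : u 0 = 0.
  by have := uL (-1) 0 0; rewrite scaler0 addr0 mulN1r addNr.
have uN x : u (- x) = - u x.
  by have := uL (-1) x 0; rewrite scaleN1r u0 !addr0 mulN1r.
have uM x : `|u x| <= M * rnorm (x : E).
  rewrite ler_norml lerNl -uN up andbT.
  by rewrite -[X in _ <= _ * X]rnormN; exact: up.
move: E A f A0 AL fL fM u uL uf up u0 uN uM.
case: s => E' A' f' A0' AL' fL' fM' u uL uf up u0 uN uM.
  exists u => //; split => // x; apply: (le_trans (uM x)).
  rewrite ler_wpM2r ?rnorm_ge0 //; lra.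
pose ii : scalars R ComplexScalars := 'i%C.
have ii1 : rabs ii = 1.
  apply: (can_inj (@ofrK R ComplexScalars)).
  by rewrite -rabsE ofr1 normc_def /= expr0n expr1n add0r sqrtr1.
pose phi (x : E') : scalars R ComplexScalars :=
  ofr _ (u x) - ii * ofr _ (u (ii *: x)).
have uZ (r : R) (x : E') : u (ofr ComplexScalars r *: x) = r * u x.
  by have := uL r x 0; rewrite realifyZ u0 !addr0.
have uD (x y : E') : u (x + y) = u x + u y.
  by have := uL 1 x y; rewrite scale1r mul1r.
exists phi; first split.
- move=> [a b] x y; rewrite /phi.
  have -> : (a +i* b)%C = ofr ComplexScalars a + ofr ComplexScalars b * ii.
    by rewrite /ii /=; simpc.
  have iib : ii * ii = -1 by rewrite /ii /=; simpc.
  have [-> ->] := imaginary_scale iib (ofr ComplexScalars a) (ofr ComplexScalars b) x y.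
  rewrite -ofrN !uD !uZ.
  by rewrite /ii /=; simpc; congr (_ +i* _)%C; ring.
- move=> x; apply: (le_trans (rnormD (_ : (_ : numFieldType)^o) _)).
  rewrite rnormN -/(rabs _) -/(rabs (ii * _)) rabsM ii1 mul1r !rabs_ofr.
  rewrite -mulrA mulr_natl mulr2n; apply: lerD; first exact: uM.
  by apply: (le_trans (uM _)); rewrite rnormZ ii1 mul1r.
- move=> x Ax; rewrite /phi uf // uf; last first.
    by have := AL' ii _ _ Ax A0'; rewrite addr0.
  have -> : f' (ii *: x) = ii * f' x.
    have f0 : f' 0 = 0.
      have := fL' (-1) _ _ A0' A0'.
      by rewrite scaler0 addr0 mulN1r addNr.
    by have := fL' ii _ _ Ax A0'; rewrite f0 !addr0.
  by case: (f' x) => a b; rewrite /ii /=; simpc.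
Qed.

Lemma biorthogonal_eval (R : realType) (s : scalar_kind)
    (E : normedModType (scalars R s)) (N : nat) (b : nat -> E)
    (f : nat -> E -> scalars R s) (M : nat -> R)
    (fM : forall i, (i < N)%N -> bounded_functional (f i) (M i))
    (fb : forall i j, (i < N)%N -> (j < N)%N -> f i (b j) = (i == j)%:R)
    (c : 'I_N -> scalars R s) (i : 'I_N) :
  f i (\sum_(j < N) c j *: b j) = c i.
Proof.
have fiM := fM _ (ltn_ord i).
rewrite (bfun_sum fiM) (bigD1 i) //= (bfunZ fiM) fb // eqxx mulr1.
rewrite big1 ?addr0 // => j ji; rewrite (bfunZ fiM) fb //.
by rewrite (_ : (i == j :> nat) = false) ?mulr0 // eq_sym; exact/negbTE.
Qed.

Lemma biorthogonal_indep (R : realType) (s : scalar_kind)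
    (E : normedModType (scalars R s)) (N : nat) (b : nat -> E)
    (f : nat -> E -> scalars R s) (M : nat -> R)
    (fM : forall i, (i < N)%N -> bounded_functional (f i) (M i))
    (fb : forall i j, (i < N)%N -> (j < N)%N -> f i (b j) = (i == j)%:R) :
  lin_indep (fun i : 'I_N => b i).
Proof.
move=> c c0 i; have := congr1 (f i) c0.
by rewrite (biorthogonal_eval fM fb) (bfun0 (fM _ (ltn_ord i))).
Qed.

(** A vector outside the span of the first [N] vectors is corrected so that
    it is killed by the first [N] functionals; a functional that is 1 there, given
    by Hahn-Banach on a line, is corrected in turn. *)
Lemma biorthogonal_system (R : realType) (s : scalar_kind)
    (E : normedModType (scalars R s)) (Einf : infinite_dimensional E) (N : nat) :
  exists (b : nat -> E) (f : nat -> E -> scalars R s) (M : nat -> R),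
    (forall i, (i < N)%N -> bounded_functional (f i) (M i)) /\
    (forall i j, (i < N)%N -> (j < N)%N -> f i (b j) = (i == j)%:R).
Proof.
elim: N => [|N [b [f [M [fM fb]]]]].
  by exists (fun=> 0), (fun=> fun=> 0), (fun=> 0).
have [x hx] : exists x, ~ lin_span (fun i : 'I_N => b i) x.
  apply/existsNP => all; apply: Einf; exists N, (fun i : 'I_N => b i).
    exact: biorthogonal_indep fM fb.
  by apply/seteqP; split=> // y _; exact: all.
pose x' := x - \sum_(i < N) f i x *: b i.
have x'0 : x' != 0.
  by apply/eqP => /eqP; rewrite subr_eq0 => /eqP xE; apply: hx; exists (f^~ x).
have fx' i : (i < N)%N -> f i x' = 0.
  move=> iN; rewrite (bfunB (fM _ iN)).
  by rewrite (biorthogonal_eval fM fb (f^~ x) (Ordinal iN)) subrr.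
have nx' : 0 < rnorm x'.
  rewrite lt_neqAle rnorm_ge0 andbT eq_sym.
  by apply: contra_neq x'0; exact: rnorm_eq0.
pose A := [set c *: x' | c in [set: scalars R s]].
have /choice [g0 g0P] : forall y, exists c, A y -> y = c *: x'.
  move=> y; have [[c _ <-]|nA] := pselect (A y); first by exists c.
  by exists 0 => /nA.
have gE c : g0 (c *: x') = c.
  have /eqP : c *: x' = g0 (c *: x') *: x' by apply: g0P; exists c.
  rewrite -subr_eq0 -scalerBl scaler_eq0 (negbTE x'0) orbF subr_eq0.
  by move=> /eqP.
have [|||a y z [c _ <-] [d _ <-]|y [c _ <-]|g gM gA] :=
    @hahn_banach_extension R s E A g0 (rnorm x')^-1.
- by rewrite invr_ge0 rnorm_ge0.
- by exists 0 => //; rewrite scale0r.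
- move=> a y z [c _ <-] [d _ <-]; exists (a * c + d) => //.
  by rewrite scalerDl scalerA.
- by rewrite scalerA -scalerDl !gE.
- by rewrite gE rnormZ mulrCA mulVf ?mulr1 // gt_eqF.
have gx' : g x' = 1.
  by rewrite gA; [rewrite -[x']scale1r gE | exists 1; rewrite ?scale1r].
(* The Gram-Schmidt correction of [g] makes it vanish on the earlier vectors. *)
pose h y := g y - \sum_(i < N) g (b i) * f i y.
pose Mh := 2 * (rnorm x')^-1 + \sum_(i < N) rabs (g (b i)) * M i.
exists (fun i => if i == N then x' else b i),
  (fun i => if i == N then h else f i), (fun i => if i == N then Mh else M i).
have hM : bounded_functional h Mh.
  split=> [a y z|y].
    rewrite /h gM.1 mulrBr [RHS]addrACA; congr (_ + _).
    rewrite mulr_sumr -opprD -big_split; congr (- _).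
    by apply: eq_bigr => i _ /=; rewrite (fM i _).1 // mulrDr mulrCA.
  apply: (le_trans (rnormD (_ : (_ : numFieldType)^o) _)).
  rewrite mulrDl; apply: lerD; first exact: gM.2.
  rewrite rnormN; apply: (le_trans (rnorm_sum _ _ _)).
  rewrite mulr_suml; apply: ler_sum => i _.
  rewrite -/(rabs (g (b i) * _)) rabsM -mulrA ler_wpM2l ?rabs_ge0 //.
  exact: (fM i _).2.
split=> [i|i j]; rewrite !ltnS => iN.
  by case: eqP => // /eqP iN'; apply: fM; rewrite ltn_neqAle iN' iN.
move=> jN; case: eqP => [->|/eqP iN']; case: eqP => [->|/eqP jN'].
- rewrite eqxx /h gx' big1 ?subr0 // => k _.
  by rewrite fx' // mulr0.
- have jN1 : (j < N)%N by rewrite ltn_neqAle jN' jN.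
  rewrite eq_sym (negbTE jN') /h (bigD1 (Ordinal jN1)) //= fb // eqxx mulr1.
  rewrite big1 ?addr0 ?subrr // => k kj; rewrite fb //.
  by rewrite (_ : (k == j :> nat) = false) ?mulr0 //; exact/negbTE.
- by rewrite (negbTE iN') fx' // ltn_neqAle iN' iN.
- by apply: fb; rewrite ltn_neqAle ?iN' ?jN'.
Qed.

(** * The Dvoretzky-Rogers lemma *)

Section EuclideanNorm.
Context (R : realType).

Definition enorm (m : nat) (a : 'rV[R]_m) : R := Num.sqrt ((a *m a^T) 0 0).

Lemma enorm_sqr m (a : 'rV[R]_m) : (a *m a^T) 0 0 = \sum_i a 0 i ^+ 2.
Proof. by rewrite mxE; apply: eq_bigr => i _; rewrite mxE expr2. Qed.

Lemma enorm_sqr_ge0 m (a : 'rV[R]_m) : 0 <= (a *m a^T) 0 0.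
Proof. by rewrite enorm_sqr sumr_ge0 // => i _; exact: sqr_ge0. Qed.

Lemma enorm_ge0 m (a : 'rV[R]_m) : 0 <= enorm a.
Proof. exact: sqrtr_ge0. Qed.

Lemma enorm_coord m (a : 'rV[R]_m) i : `|a 0 i| <= enorm a.
Proof.
rewrite -sqrtr_sqr /enorm ler_wsqrtr // enorm_sqr (bigD1 i) //= lerDl.
by rewrite sumr_ge0 // => j _; exact: sqr_ge0.
Qed.

Lemma enorm_delta m (i : 'I_m) : enorm (delta_mx 0 i) = 1.
Proof.
rewrite /enorm enorm_sqr (bigD1 i) //= mxE !eqxx expr1n big1 ?addr0 ?sqrtr1 //.
by move=> j ji; rewrite mxE eqxx (negbTE ji) expr0n.
Qed.

Lemma enorm_isometry m p (U : 'M[R]_(p, m)) (c : 'rV[R]_p) :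
  U *m U^T = 1%:M -> enorm (c *m U) = enorm c.
Proof. by move=> UU; rewrite /enorm trmx_mul mulmxA -(mulmxA c) UU mulmx1. Qed.

Lemma enorm_proj m p (U : 'M[R]_(p, m)) (a : 'rV[R]_m) :
  U *m U^T = 1%:M -> enorm (a *m (1%:M - U^T *m U)) <= enorm a.
Proof.
move=> UU; rewrite /enorm ler_wsqrtr //.
have PP : (1%:M - U^T *m U) *m (1%:M - U^T *m U)^T = 1%:M - U^T *m U.
  rewrite linearB /= trmx1 trmx_mul trmxK mulmxBr mulmx1 mulmxBl mul1mx.
  by rewrite mulmxA -(mulmxA U^T) UU mulmx1 subrr subr0.
rewrite trmx_mul mulmxA -(mulmxA a) PP mulmxBr mulmx1 mulmxBl.
rewrite 2!mxE gerDl mxE oppr_le0.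
have -> : a *m (U^T *m U) *m a^T = (a *m U^T) *m (a *m U^T)^T.
  by rewrite trmx_mul trmxK !mulmxA.
exact: enorm_sqr_ge0.
Qed.

(** The matrix 1 + P, for P the projection onto the orthogonal complement of
    the [p] orthonormal rows of [U], has eigenvalues 1 and 2 with multiplicities
    [p] and [m - p]. Two block factorizations of one matrix replace the
    diagonalization. *)
Lemma det_add_proj m p (U : 'M[R]_(p, m)) :
  U *m U^T = 1%:M -> 2 ^+ p * \det (1%:M + (1%:M - U^T *m U)) = 2 ^+ m.
Proof.
move=> UU.
have E1 : block_mx 1%:M U (U^T) (2%:M : 'M[R]_m) =
    block_mx (1%:M : 'M[R]_p) 0 (U^T) 1%:M *m
    block_mx 1%:M U 0 (1%:M + (1%:M - U^T *m U)).
  rewrite mulmx_block !mul1mx !mulmx1 !mul0mx ?mulmx0 !addr0.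
  by rewrite [U^T *m U + _]addrC -addrA subrK -(raddfD (@scalar_mx R m)).
have E2 : block_mx 1%:M U (U^T) (2%:M : 'M[R]_m) =
    block_mx 1%:M (2^-1 *: U) 0 1%:M *m
    block_mx ((2^-1)%:M : 'M[R]_p) 0 (U^T) 2%:M.
  rewrite mulmx_block !mul1mx !mul0mx ?mulmx0 ?add0r -!scalemxAl UU.
  rewrite mul_mx_scalar scalerA mulVf ?scale1r ?pnatr_eq0 //.
  congr block_mx; rewrite -mul_scalar_mx mulmx1 -(raddfD (@scalar_mx R p)).
  by congr (_%:M); lra.
have := congr1 determinant E1; rewrite {1}E2 !det_mulmx.
rewrite !det_ublock !det_lblock !det1 !mul1r => <-.
by rewrite !det_scalar mulrA -exprMn divff ?expr1n ?mul1r ?pnatr_eq0.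
Qed.

End EuclideanNorm.

Section DvoretzkyRogers.
Context (R : realType) (V : lmodType R) (nrm : V -> R).
Context (nrmD : forall x y, nrm (x + y) <= nrm x + nrm y).
Context (nrmZ : forall a x, nrm (a *: x) = `|a| * nrm x).

Definition comb (m : nat) (y : 'I_m -> V) (a : 'rV[R]_m) : V :=
  \sum_i a 0 i *: y i.

Lemma comb_linear m (y : 'I_m -> V) t a b :
  comb y (t *: a + b) = t *: comb y a + comb y b.
Proof.
rewrite /comb scaler_sumr -big_split; apply: eq_bigr => i _ /=.
by rewrite !mxE scalerDl scalerA.
Qed.

Lemma combZ m (y : 'I_m -> V) t a : comb y (t *: a) = t *: comb y a.
Proof.
by rewrite /comb scaler_sumr; apply: eq_bigr => i _; rewrite mxE scalerA.
Qed.

Lemma comb_delta m (y : 'I_m -> V) i : comb y (delta_mx 0 i) = y i.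
Proof.
rewrite /comb (bigD1 i) //= mxE !eqxx scale1r big1 ?addr0 // => j ji.
by rewrite mxE eqxx (negbTE ji) scale0r.
Qed.

Lemma comb_mulmx m p (y : 'I_m -> V) (A : 'M[R]_(p, m)) a :
  comb (fun i => comb y (row i A)) a = comb y (a *m A).
Proof.
rewrite /comb; under eq_bigr do rewrite scaler_sumr.
rewrite exchange_big /=; apply: eq_bigr => j _.
by rewrite mxE scaler_suml; apply: eq_bigr => i _; rewrite mxE scalerA.
Qed.

Lemma nrm0 : nrm 0 = 0.
Proof. by rewrite -(scale0r 0) nrmZ normr0 mul0r. Qed.

Lemma nrm_ge0 x : 0 <= nrm x.
Proof.
have := nrmD x (-1 *: x); rewrite nrmZ normrN1 mul1r scaleN1r subrr nrm0.
by lra.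
Qed.

Lemma nrm_sum (I : Type) (r : seq I) (P : pred I) (f : I -> V) :
  nrm (\sum_(i <- r | P i) f i) <= \sum_(i <- r | P i) nrm (f i).
Proof.
elim/big_rec2: _ => [|i a b _ h]; first by rewrite nrm0.
by apply: (le_trans (nrmD _ _)); rewrite lerD2l.
Qed.

(** The operator from Euclidean space that sends the basis to [y] has norm at
    most 1; this is the weak-2-norm of the family [y]. *)
Definition contraction (m : nat) (y : 'I_m -> V) : Prop :=
  forall a, nrm (comb y a) <= enorm a.

Section MaximalDeterminant.
Context (m : nat) (b : 'I_m -> V) (f : 'I_m -> V -> R) (M : R).
Context (fL : forall i a x y, f i (a *: x + y) = a * f i x + f i y).
Context (fM : forall i x, `|f i x| <= M * nrm x).
Context (fb : forall i j, f i (b j) = (i == j)%:R).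

(** The family [y] need not span the same subspace as [b]: the functionals
    [f] provide coordinates, hence a determinant, for any family. *)
Definition coord_det (y : 'I_m -> V) : R := \det (\matrix_(i, j) f j (y i)).

Lemma functional0 i : f i 0 = 0.
Proof.
by have := fL i (-1) 0 0; rewrite scaler0 addr0 mulN1r addNr.
Qed.

Lemma f_comb i (y : 'I_m -> V) a : f i (comb y a) = \sum_j a 0 j * f i (y j).
Proof.
rewrite /comb; have fD x z : f i (x + z) = f i x + f i z.
  by rewrite -[x]scale1r fL mul1r scale1r.
rewrite (big_morph (f i) fD (functional0 i)); apply: eq_bigr => j _.
by rewrite -[a 0 j *: y j]addr0 fL functional0 addr0.
Qed.

Lemma coord_det_mul (y : 'I_m -> V) (A : 'M[R]_m) :
  coord_det (fun i => comb y (row i A)) = \det A * coord_det y.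
Proof.
rewrite /coord_det -det_mulmx; congr (\det _); apply/matrixP => i j.
by rewrite !mxE f_comb; apply: eq_bigr => k _; rewrite !mxE.
Qed.

Lemma coord_det_scale (t : R) (y : 'I_m -> V) :
  coord_det (fun i => t *: y i) = t ^+ m * coord_det y.
Proof.
rewrite -det_scalar -coord_det_mul; congr coord_det; apply/funext => i.
rewrite /comb (bigD1 i) //= !mxE eqxx mulr1n big1 ?addr0 // => j ji.
by rewrite !mxE eq_sym (negbTE ji) mulr0n scale0r.
Qed.

Lemma coord_det_bounded (y : 'I_m -> V) : contraction y ->
  `|coord_det y| <= \sum_(s : {perm 'I_m}) `|M| ^+ m.
Proof.
move=> yc; apply: (le_trans (ler_norm_sum _ _ _)); apply: ler_sum => s _.
rewrite normrM normrX normrN1 expr1n mul1r normr_prod.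
apply: (@le_trans _ _ (\prod_(i < m) `|M|)); last by rewrite prodr_const card_ord.
apply: ler_prod => i _; rewrite normr_ge0 mxE /=.
apply: (le_trans (fM _ _)); apply: (@le_trans _ _ (`|M| * nrm (y i))).
  by rewrite ler_wpM2r ?nrm_ge0 ?ler_norm.
rewrite ler_piMr //; have := yc (delta_mx 0 i).
by rewrite comb_delta enorm_delta.
Qed.

(** The determinant is bounded on contractions since each coordinate is, and
    a small multiple of [b] shows that its supremum is positive. Coming within a
    factor 3/4 of the supremum is enough and spares a compactness argument. *)
Lemma near_maximal_contraction : exists y : 'I_m -> V,
  [/\ contraction y, 0 < `|coord_det y|
    & forall z, contraction z -> 3 / 4 * `|coord_det z| <= `|coord_det y|].
Proof.
pose S := [set `|coord_det y| | y in contraction (m := m)].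
pose c := (1 + \sum_i nrm (b i))^-1.
have sb0 : 0 <= \sum_i nrm (b i) by rewrite sumr_ge0 // => i _; exact: nrm_ge0.
have c0 : 0 < c by rewrite invr_gt0; lra.
have cb : contraction (fun i => c *: b i).
  move=> a; rewrite /comb.
  under eq_bigr do rewrite scalerA mulrC -scalerA.
  rewrite -scaler_sumr nrmZ ger0_norm ?(ltW c0) //.
  rewrite mulrC ler_pdivrMr; last lra.
  apply: (le_trans (nrm_sum _ _ _)).
  apply: (@le_trans _ _ (\sum_i enorm a * nrm (b i))).
    by apply: ler_sum => i _; rewrite nrmZ ler_wpM2r ?nrm_ge0 ?enorm_coord.
  by rewrite -mulr_sumr ler_wpM2l ?enorm_ge0 //; lra.
have Db : coord_det (fun i => c *: b i) = c ^+ m.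
  rewrite coord_det_scale (_ : coord_det b = 1) ?mulr1 //.
  rewrite -(@det1 R m); congr (\det _); apply/matrixP => i j.
  by rewrite !mxE fb eq_sym.
have hS : has_sup S.
  split; first by exists `|coord_det (fun i => c *: b i)|, (fun i => c *: b i).
  exists (\sum_(s : {perm 'I_m}) `|M| ^+ m) => _ [y yc <-]; exact: coord_det_bounded.
have S0 : 0 < sup S.
  apply: (@lt_le_trans _ _ `|coord_det (fun i => c *: b i)|).
    by rewrite Db gtr0_norm exprn_gt0.
  by apply: sup_upper_bound => //; exists (fun i => c *: b i).
have e0 : 0 < sup S / 4 by rewrite divr_gt0.
have [_ [y yc <-] yS] := sup_adherent e0 hS.
exists y; split=> //; first by lra.
move=> z zc; have : `|coord_det z| <= sup S.
  by apply: sup_upper_bound => //; exists z.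
by lra.
Qed.

End MaximalDeterminant.

(** Let [y] be a contraction of [n + n] vectors with nearly maximal
    determinant. Rows u of Euclidean norm 1 with [nrm (comb y u) >= 1/4] are
    chosen one by one, each orthogonal to the previous ones. The first [n] choices
    cannot fail: if [comb y] had norm at most 1/4 on the orthogonal
    complement of p < n rows, with projection P, then composing [comb y]
    with 4/5 (1 + P) would give a contraction, and multiply the determinant by
    (4/5)^(2n) 2^(2n-p), which is at least 2 (32/25)^n and so exceeds 4/3. *)
Lemma dvoretzky_rogers (n : nat) (b : 'I_(n + n) -> V)
    (f : 'I_(n + n) -> V -> R) (M : R)
    (fL : forall i a x y, f i (a *: x + y) = a * f i x + f i y)
    (fM : forall i x, `|f i x| <= M * nrm x)
    (fb : forall i j, f i (b j) = (i == j)%:R) :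
  exists z : 'I_n -> V, contraction z /\ forall i, 4^-1 <= nrm (z i).
Proof.
have [y [yc Dy ymax]] := near_maximal_contraction fL fM fb.
suff H p : (p <= n)%N -> exists U : 'M[R]_(p, n + n),
    U *m U^T = 1%:M /\ forall i, 4^-1 <= nrm (comb y (row i U)).
  have [U [UU Un]] := H n (leqnn n).
  exists (fun i => comb y (row i U)); split=> // a.
  by rewrite comb_mulmx -(enorm_isometry a UU); exact: yc.
elim: p => [|p IH] pn.
  by exists 0; split; [apply/matrixP => -[] | case].
have [U [UU Un]] := IH (ltnW pn).
pose P : 'M[R]_(n + n) := 1%:M - U^T *m U.
have [a ha] : exists a, 4^-1 * enorm a < nrm (comb y (a *m P)).
  apply: contrapT => no.
  have small a : nrm (comb y (a *m P)) <= 4^-1 * enorm a.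
    by rewrite leNgt; apply/negP => h; apply: no; exists a.
  pose z i := (4 / 5) *: comb y (row i (1%:M + P)).
  have zc : contraction z.
    move=> a; have -> : comb z a = (4 / 5) *: comb y (a *m (1%:M + P)).
      rewrite -comb_mulmx /comb scaler_sumr; apply: eq_bigr => i _.
      by rewrite /z !scalerA mulrC.
    rewrite nrmZ ger0_norm; last lra.
    rewrite mulmxDr mulmx1 -[a in a + _]scale1r comb_linear scale1r.
    have := nrmD (comb y a) (comb y (a *m P)).
    have := yc a; have := small a; lra.
  have := ymax z zc; rewrite /z (coord_det_scale fL) (coord_det_mul fL).
  rewrite !normrM mulrA mulrA -[leRHS]mul1r ler_pM2r //.
  have detP : 2 ^+ n.+1 <= \det (1%:M + P).
    have := det_add_proj UU; rewrite -/P => dP.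
    have p2 : (0 : R) < 2 ^+ p by rewrite exprn_gt0.
    rewrite -(ler_pM2l p2) dP -exprD ler_weXn2l //; first lra.
    by rewrite addnS -addSn leq_add2r.
  have c45 : (0 : R) < 4 / 5 by lra.
  have c0 : (0 : R) < (4 / 5) ^+ (n + n) by rewrite exprn_gt0.
  rewrite (gtr0_norm c0).
  have d0 : (0 : R) <= 2 ^+ n.+1 by rewrite exprn_ge0.
  rewrite ger0_norm; last exact: (le_trans d0).
  apply/negP; rewrite -ltNge.
  apply: (@lt_le_trans _ _ (3 / 4 * (4 / 5) ^+ (n + n) * 2 ^+ n.+1)); last first.
    by rewrite -mulrA ler_pM2l; [rewrite ler_pM2l | lra].
  have -> : 3 / 4 * (4 / 5) ^+ (n + n) * 2 ^+ n.+1 = 3 / 2 * (32 / 25) ^+ n :> R.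
    rewrite exprD -exprMn exprS.
    have -> : (32 / 25 : R) = (4 / 5) * (4 / 5) * 2 by lra.
    by rewrite (exprMn _ (4 / 5 * (4 / 5)) 2); field.
  have : (1 : R) <= (32 / 25) ^+ n by rewrite exprn_ege1 //; lra.
  lra.
pose v := a *m P.
have va : enorm v <= enorm a by exact: enorm_proj.
have v0 : 0 < enorm v.
  have nv : 0 < nrm (comb y v).
    by apply: (le_lt_trans _ ha); rewrite mulr_ge0 ?enorm_ge0 //; lra.
  by apply: (lt_le_trans nv); exact: yc.
have vU : v *m U^T = 0.
  rewrite /v /P -mulmxA mulmxBl mul1mx -(mulmxA U^T) UU mulmx1 subrr.
  by rewrite mulmx0.
pose u := (enorm v)^-1 *: v.
have uU : u *m U^T = 0 by rewrite /u -scalemxAl vU scaler0.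
have uu : u *m u^T = 1%:M.
  apply/matrixP => i j; rewrite !ord1.
  rewrite /u -scalemxAl linearZ /= -scalemxAr scalerA mxE -expr2.
  have <- : enorm v ^+ 2 = (v *m v^T) 0 0 by rewrite sqr_sqrtr ?enorm_sqr_ge0.
  by rewrite -exprMn mulVf ?gt_eqF // expr1n mxE eqxx.
have WW : col_mx u U *m (col_mx u U)^T = 1%:M.
  rewrite tr_col_mx mul_col_row uu UU uU.
  have -> : U *m u^T = 0 by rewrite -[U *m _]trmxK trmx_mul trmxK uU trmx0.
  exact/esym/scalar_mx_block.
suff rows (i : 'I_(1 + p)) : 4^-1 <= nrm (comb y (row i (col_mx u U))).
  by exists (col_mx u U : 'M[R]_(1 + p, _)).
case: (@fintype.splitP 1 p i) => j ij.
  have -> : i = lshift p j by exact: val_inj.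
  rewrite rowKu (_ : row j u = u); last by apply/rowP => k; rewrite mxE ord1.
  rewrite combZ nrmZ ger0_norm ?invr_ge0 ?enorm_ge0 //.
  rewrite mulrC ler_pdivlMr //; apply: (le_trans _ (ltW ha)).
  by rewrite ler_wpM2l //; lra.
have -> : i = rshift 1 j by exact: val_inj.
by rewrite rowKd.
Qed.

End DvoretzkyRogers.

(** With N = k^2 orthonormal directions of norm at least 1/4, real coefficients
    bounded by [t] have Euclidean norm at most k t, so sums are bounded by 2 k t for
    scalar coefficients; after division by 2 k the norms still add up to k/8. *)
Lemma large_unconditional_family (R : realType) (s : scalar_kind)
    (F : normedModType (scalars R s)) (Finf : infinite_dimensional F) (C : R) :
  exists (N : nat) (y : 'I_N -> F),
    (forall (a : 'I_N -> scalars R s) t, 0 <= t ->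
       (forall j, rabs (a j) <= t) -> rnorm (\sum_j a j *: y j) <= t) /\
    C <= \sum_j rnorm (y j).
Proof.
pose k := (Num.bound (8 * `|C|)).+1; pose n := (k * k)%N.
have k0 : (0 : R) < k%:R by rewrite ltr0n.
have kC : 8 * C <= k%:R.
  have : 8 * `|C| < (Num.bound (8 * `|C|))%:R.
    by have := archi_boundP (_ : 0 <= 8 * `|C|); apply; rewrite mulr_ge0.
  have := ler_norm C; have : (Num.bound (8 * `|C|))%:R <= k%:R :> R by rewrite ler_nat.
  lra.
have [b [f [M [fM fb]]]] := biorthogonal_system Finf (n + n).
pose g (i : 'I_(n + n)) (x : realify F) := real_value (f i x).
have gL i a x y : g i (a *: x + y) = a * g i x + g i y.
  by rewrite /g realifyZ (fM i _).1 // real_value_real_linear.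
have gM i (x : realify F) : `|g i x| <= (\sum_(j < n + n) `|M j|) * rnorm (x : F).
  apply: (@le_trans _ _ (rabs (f i x))).
    exact: real_value_norm_le.
  apply: (le_trans ((fM i (ltn_ord i)).2 x)); rewrite ler_wpM2r ?rnorm_ge0 //.
  rewrite (bigD1 i) //= -[leLHS]addr0 lerD ?ler_norm // sumr_ge0 //.
have gb (i j : 'I_(n + n)) : g i (b j) = (i == j)%:R.
  rewrite /g fb // [in RHS](_ : (i == j) = (i == j :> nat)) //.
  case: (i == j :> nat).
    by rewrite -(@ofr1 R s) ofrK.
  by rewrite !mulr0n -(@ofr0 R s) ofrK.
have [z [zc zn]] := @dvoretzky_rogers R (realify F) (fun x => rnorm (x : F))
  (fun x y => rnormD (x : F) y) (fun a x => rnormZr a (x : F)) n b g _ gL gM gb.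
have zR (a : 'I_n -> R) t : 0 <= t -> (forall j, `|a j| <= t) ->
    rnorm (\sum_j ofr s (a j) *: (z j : F)) <= k%:R * t.
  move=> t0 at_; have := zc (\row_j a j).
  have -> : comb z (\row_j a j) = \sum_j ofr s (a j) *: (z j : F) :> F.
    by apply: eq_bigr => j _; rewrite realifyZ mxE.
  move=> /le_trans; apply.
  rewrite -(@ger0_norm _ (k%:R * t)); last by rewrite mulr_ge0 // ltW.
  rewrite -sqrtr_sqr /enorm ler_wsqrtr // enorm_sqr.
  apply: (@le_trans _ _ (\sum_(i < n) t ^+ 2)).
    apply: ler_sum => i _; rewrite mxE -(real_normK (num_real (a i))).
    by rewrite ler_pXn2r ?nnegrE ?normr_ge0.
  by rewrite sumr_const card_ord exprMn -[_ *+ n]mulr_natl /n natrM expr2.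
have [j j1 jP] := scalar_split R s.
exists n, (fun i => ofr s (2 * k%:R)^-1 *: (z i : F)); split=> [a t t0 at_|].
  have /choice [u /choice [v uv]] : forall i, exists u v : R,
    [/\ a i = ofr s u + j * ofr s v, `|u| <= rabs (a i) & `|v| <= rabs (a i)].
    by move=> i; exact: jP.
  have -> : \sum_i a i *: (ofr s (2 * k%:R)^-1 *: (z i : F)) =
      ofr s (2 * k%:R)^-1 *: (\sum_i ofr s (u i) *: (z i : F) +
        j *: \sum_i ofr s (v i) *: (z i : F)).
    rewrite !scaler_sumr -big_split scaler_sumr; apply: eq_bigr => i _ /=.
    rewrite [j *: _]scalerA -scalerDl !scalerA mulrC.
    by have [<- _ _] := uv i.
  rewrite rnormZr gtr0_norm; last by rewrite invr_gt0 mulr_gt0.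
  rewrite mulrC ler_pdivrMr ?mulr_gt0 //.
  apply: (le_trans (rnormD _ _)); rewrite rnormZ.
  have hu : rnorm (\sum_i ofr s (u i) *: (z i : F)) <= k%:R * t.
    by apply: zR => // i; have [_ h _] := uv i; apply: (le_trans h).
  have hv : rnorm (\sum_i ofr s (v i) *: (z i : F)) <= k%:R * t.
    by apply: zR => // i; have [_ _ h] := uv i; apply: (le_trans h).
  have := ler_wpM2r (rnorm_ge0 (\sum_i ofr s (v i) *: (z i : F))) j1.
  lra.
apply: (@le_trans _ _ (\sum_(i < n) (2 * k%:R)^-1 * 4^-1)); last first.
  apply: ler_sum => i _; rewrite rnormZr gtr0_norm ?invr_gt0 ?mulr_gt0 //.
  by rewrite ler_pM2l ?invr_gt0 ?mulr_gt0.
rewrite sumr_const card_ord -[_ *+ n]mulr_natl /n natrM.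
have -> : k%:R * k%:R * ((2 * k%:R)^-1 * 4^-1) = k%:R / 8 :> R.
  by field; rewrite gt_eqF.
lra.
Qed.

(** * Copies of l_oo^N in L_oo-spaces *)

Section RowNorm.
Context (R : realType) (s : scalar_kind).
Local Notation K := (scalars R s).

Lemma rabs_row_le m (x : 'rV[K]_m) j : rabs (x 0 j) <= rnorm x.
Proof.
rewrite -(@ofr_le R s) -rabsE -normE.
rewrite [leRHS]/Num.Def.normr /= /mx_norm.
by rewrite -[leLHS]nngE num_le; exact: (le_bigmax _ _ (0, j)).
Qed.

Lemma rnorm_row_le m (x : 'rV[K]_m) (t : R) : 0 <= t ->
  (forall j, rabs (x 0 j) <= t) -> rnorm x <= t.
Proof.
move=> t0 xt; have [x0|x0] := eqVneq (mx_norm x) 0.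
  by rewrite (mx_norm_eq0 x0) rnorm0.
have [[i j] /= xE] := mx_norm_neq0 x0.
rewrite -(@ofr_le R s) -normE [leLHS]xE ord1 rabsE ofr_le.
exact: xt.
Qed.

End RowNorm.

(** The space contains copies of l_oo^N, for all [N], that are complemented by
    [p], with constants independent of [N]. The last clause says that the [x j] have
    weak-1-norm at most [L]. *)
Definition uniform_cubes (R : realType) (s : scalar_kind)
    (E : normedModType (scalars R s)) (L : R) : Prop :=
  forall N, exists (x : 'I_N -> E) (p : 'I_N -> E -> scalars R s),
    [/\ forall j, bounded_functional (p j) 1,
        forall j l, p j (x l) = (j == l)%:R
      & forall a : 'I_N -> scalars R s, (forall j, rabs (a j) <= 1) ->
          rnorm (\sum_j a j *: x j) <= L].

(** A matrix with more rows than columns has a nonzero left kernel. *)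
Lemma indep_size_le (K : numFieldType) (E : normedModType K) (N m : nat)
    (b : 'I_N -> E) (e : 'I_m -> E) :
  lin_indep b -> (forall i, lin_span e (b i)) -> (N <= m)%N.
Proof.
move=> bI /choice [c bE]; rewrite leqNgt; apply/negP => mN.
pose A := \matrix_(i, j) c i j.
have : kermx A != 0.
  rewrite kermx_eq0 -row_leq_rank -ltnNge.
  exact: (leq_ltn_trans (rank_leq_col A)).
have := mulmx_ker A; move: (kermx A) => B BA /matrix0Pn [k [l kl]].
have b0 : \sum_i B k i *: b i = 0.
  under eq_bigr do rewrite bE scaler_sumr.
  rewrite exchange_big /= big1 // => j _.
  under eq_bigr do rewrite scalerA.
  rewrite -scaler_suml (_ : \sum_i B k i * c i j = 0) ?scale0r //.
  have /matrixP /(_ k j) := BA; rewrite mxE [RHS]mxE => BAkj.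
  rewrite -[RHS]BAkj.
  by apply: eq_bigr => i _; rewrite !mxE.
by have := bI _ b0 l => /eqP; apply/negP.
Qed.

Section OperatorNorm.
Context (R : realType) (s : scalar_kind) (X Y : normedModType (scalars R s)).
Context (A : set X) (f : X -> Y).
Context (AZ : forall a x, A x -> A (a *: x)).
Context (fZ : forall a x, A x -> f (a *: x) = a *: f x).

(** Positivity of both operator norms excludes the product of 0 and infinity,
    so that a finite Banach-Mazur bound makes both norms finite. *)
Lemma opnorm_gt0 x : A x -> f x != 0 -> (0 < opnorm_on A f)%E.
Proof.
move=> Ax fx0; have x0 : 0 < rnorm x.
  rewrite lt_neqAle rnorm_ge0 andbT eq_sym; apply: contra_neq fx0.
  by move=> /rnorm_eq0 ->; rewrite -(scale0r x) fZ // scale0r.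
have fx : 0 < rnorm (f x).
  rewrite lt_neqAle rnorm_ge0 andbT eq_sym.
  by apply: contra_neq fx0; exact: rnorm_eq0.
pose u := ofr s (rnorm x)^-1 *: x.
apply: (@lt_le_trans _ _ (rnorm (f u))%:E).
  rewrite lte_fin fZ // rnormZr mulr_gt0 // normr_gt0 invr_eq0 gt_eqF //.
apply: ereal_sup_ubound; exists u => //; split; first exact: AZ.
by rewrite rnormZr gtr0_norm ?invr_gt0 // mulVf // gt_eqF.
Qed.

Lemma opnorm_bound (M : R) x : opnorm_on A f = M%:E -> A x ->
  rnorm (f x) <= M * rnorm x.
Proof.
move=> fM Ax; have [x0|x0] := eqVneq (rnorm x) 0.
  rewrite x0 mulr0 (rnorm_eq0 x0) -(scale0r x) fZ // scale0r rnorm0 //.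
have xp : 0 < rnorm x by rewrite lt_neqAle rnorm_ge0 andbT eq_sym.
pose u := ofr s (rnorm x)^-1 *: x.
have : ((rnorm (f u))%:E <= M%:E)%E.
  rewrite -fM; apply: ereal_sup_ubound; exists u => //; split; first exact: AZ.
  by rewrite rnormZr gtr0_norm ?invr_gt0 // mulVf.
rewrite lee_fin fZ // rnormZr gtr0_norm ?invr_gt0 //.
by rewrite mulrC ler_pdivrMr.
Qed.

End OperatorNorm.

(** A subspace of dimension [N.+1] lies in a [G] that is (la+1)-isomorphic to some
    l_oo^m by [f], and m > N. Hahn-Banach extends the coordinates of [f] to the whole
    space; they are biorthogonal to the images of the unit vectors under the
    inverse of [f]. Rescaling by twice the norm of [f] makes the functionals
    contractive and leaves only the product of the norms of [f] and its inverse. *)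
Lemma script_Linfty_cubes (R : realType) (s : scalar_kind)
    (E : normedModType (scalars R s)) :
  infinite_dimensional E -> script_Linfty_space E ->
  exists L, uniform_cubes E L.
Proof.
move=> Einf [la la1 EL]; exists (2 * (la + 1)) => N.
(* One vector more than needed, so that [G] is not zero when [N] is. *)
have [b [h [M [hM hb]]]] := biorthogonal_system Einf N.+1.
have bI := biorthogonal_indep hM hb.
have [|G [m [[e eI GE] bG BM]]] := EL (lin_span (fun i : 'I_N.+1 => b i)).
  by exists N.+1, (fun i : 'I_N.+1 => b i).
have Gb (i : 'I_N.+1) : G (b i).
  apply: bG; exists (fun j => (j == i)%:R).
  rewrite (bigD1 i) //= eqxx scale1r big1 ?addr0 // => j /negbTE ->.
  by rewrite scale0r.
have Nm : (N < m)%N.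
  by apply: (indep_size_le bI (e := e)) => i; rewrite -GE.
have G0 : G 0.
  by rewrite GE; exists (fun=> 0); rewrite big1 // => i _; rewrite scale0r.
have GL a x y : G x -> G y -> G (a *: x + y).
  rewrite GE => -[c ->] [d ->]; exists (fun i => a * c i + d i).
  rewrite scaler_sumr -big_split; apply: eq_bigr => i _ /=.
  by rewrite scalerDl scalerA.
have GZ a x : G x -> G (a *: x) by move=> Gx; rewrite -[_ *: _]addr0; exact: GL.
have : (banach_mazur G [set: 'rV[scalars R s]_m] < (la + 1)%:E)%E.
  by apply: (le_lt_trans BM); rewrite lte_fin ltrDl.
move=> /ereal_inf_lt [_ [f [g [fL fbij gf ->]]] fgla].
have fsurj y : exists2 x, G x & f x = y.
  case: fbij => _ _ fs.
  by have [x Gx fx] := fs y Logic.I; exists x.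
have f0 : f 0 = 0.
  by have := fL (-1) _ _ G0 G0; rewrite scaler0 addr0 scaleN1r addNr.
have fZ a x : G x -> f (a *: x) = a *: f x.
  by move=> Gx; have := fL a _ _ Gx G0; rewrite f0 !addr0.
have Gg y : G (g y) by have [x Gx <-] := fsurj y; rewrite gf.
have fg y : f (g y) = y by have [x Gx <-] := fsurj y; rewrite gf.
have gL a y z : g (a *: y + z) = a *: g y + g z.
  by rewrite -{1}(fg y) -{1}(fg z) -fL // gf //; exact: GL.
have g0 : g 0 = 0.
  by have := gL (-1) 0 0; rewrite scaler0 addr0 scaleN1r addNr.
have gZ a y : g (a *: y) = a *: g y by have := gL a y 0; rewrite g0 !addr0.
have gD y z : g (y + z) = g y + g z by have := gL 1 y z; rewrite !scale1r.
have b0 : b 0%N != 0.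
  apply/eqP => b0; have := hb 0%N 0%N isT isT.
  by rewrite b0 (bfun0 (hM 0%N isT)) => /eqP; rewrite eq_sym oner_eq0.
have fb0 : f (b 0%N) != 0.
  apply: contra_neq b0 => fb0; rewrite -[LHS](gf _ (Gb ord0)).
  by rewrite [f _]fb0 g0.
have fp := opnorm_gt0 GZ fZ (Gb ord0) fb0.
have gb0 : g (f (b 0%N)) != 0 by rewrite gf //; exact: (Gb ord0).
have gp := @opnorm_gt0 R s _ _ setT g (fun _ _ _ => Logic.I) (fun a y _ => gZ a y)
  (f (b 0%N)) Logic.I gb0.
have [al [be [alE beE al0 be0 abla]]] : exists al be : R,
    [/\ opnorm_on G f = al%:E, opnorm_on setT g = be%:E, 0 < al, 0 < be
      & al * be <= la + 1].
  move: fp gp fgla.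
  case: (opnorm_on G f) => [al| |] //; case: (opnorm_on setT g) => [be| |] //.
  - rewrite !lte_fin => al0 be0 ab; exists al, be; split=> //.
    by rewrite -lee_fin ltW.
  - by rewrite lte_fin => al0 _; rewrite gt0_muley ?lte_fin.
  - by rewrite lte_fin => _ be0; rewrite gt0_mulye ?lte_fin.
have fM x : G x -> rnorm (f x) <= al * rnorm x by exact: (opnorm_bound GZ fZ alE).
have gM y : rnorm (g y) <= be * rnorm y.
  exact: (@opnorm_bound R s _ _ setT g (fun _ _ _ => Logic.I) (fun a z _ => gZ a z)).
pose w (j : 'I_N) : 'I_m := widen_ord (ltnW Nm) j.
have /choice [q qP] : forall j : 'I_m, exists phi : E -> scalars R s,
    bounded_functional phi (2 * al) /\ forall x, G x -> phi x = f x 0 j.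
  move=> j; have [||||x Gx|phi phiM phiG] :=
      @hahn_banach_extension R s E G (fun x => f x 0 j) al.
  - exact: ltW.
  - exact: G0.
  - exact: GL.
  - by move=> a x y Gx Gy; rewrite fL // !mxE.
  - by apply: (le_trans (rabs_row_le _ _)); exact: fM.
  - by exists phi.
have al20 : 0 < 2 * al by rewrite mulr_gt0.
exists (fun j => ofr s (2 * al) *: g (delta_mx 0 (w j))),
  (fun j x => ofr s (2 * al)^-1 * q (w j) x); split.
- move=> j; have [qM _] := qP (w j); split=> [a x y|x].
    by rewrite qM.1 mulrDr mulrCA.
  rewrite rabsM rabs_ofr gtr0_norm ?invr_gt0 // mul1r mulrC ler_pdivrMr //.
  by rewrite mulrC; exact: qM.2.
- move=> j l; have [qM qG] := qP (w j).
  have c1 : ofr s (2 * al)^-1 * ofr s (2 * al) = 1.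
    by rewrite -ofrM mulVf ?ofr1 // gt_eqF.
  rewrite (bfunZ qM) qG // fg mulrA c1 mul1r mxE eqxx.
  by rewrite -val_eqE.
- move=> a a1.
  have -> : \sum_j a j *: (ofr s (2 * al) *: g (delta_mx 0 (w j))) =
      ofr s (2 * al) *: g (\sum_j a j *: delta_mx 0 (w j)).
    rewrite (big_morph g gD g0) scaler_sumr; apply: eq_bigr => j _.
    by rewrite gZ !scalerA mulrC.
  rewrite rnormZr gtr0_norm //.
  apply: (@le_trans _ _ (2 * al * be)); last by rewrite -mulrA ler_pM2l.
  rewrite ler_pM2l // -[leRHS]mulr1; apply: (le_trans (gM _)).
  rewrite ler_pM2l //; apply: rnorm_row_le => // l; rewrite summxE.
  have [[j <-]|nl] := pselect (exists j, w j = l).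
    rewrite (bigD1 j) //= !mxE !eqxx mulr1 big1 ?addr0 // => i ij.
    rewrite !mxE eqxx /= (_ : (w j == w i) = false) ?mulr0 //.
    by rewrite -val_eqE /= eq_sym; exact/negbTE.
  rewrite big1 ?rabs0 // => j _; rewrite !mxE eqxx /=.
  by case: eqP => [lE|]; [case: nl; exists j | rewrite mulr0].
Qed.

(** * A gliding hump *)

Lemma geometric_small (R : realType) (C e : R) : 0 < e ->
  exists k, C * 4^-1 ^+ k <= e.
Proof.
move=> e0; exists (Num.bound (`|C| / e)); set k := Num.bound _.
have kC : `|C| / e < k%:R.
  by have := archi_boundP (_ : 0 <= `|C| / e); apply; rewrite divr_ge0 // ltW.
have k4 : k%:R <= 4 ^+ k :> R.
  by rewrite -natrX ler_nat ltnW // ltn_expl.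
rewrite exprVn ler_pdivrMr ?exprn_gt0 //.
apply: (le_trans (ler_norm C)); move: kC; rewrite ltr_pdivrMr // => /ltW.
by move=> /le_trans; apply; rewrite mulrC ler_pM2l.
Qed.

Lemma geometric_limit (R : realType) (s : scalar_kind)
    (F : completeNormedModType (scalars R s)) (u : nat -> F) (C : R) :
  (forall k l, (k <= l)%N -> rnorm (u l - u k) <= C * 4^-1 ^+ k) ->
  exists v, forall k, rnorm (v - u k) <= C * 4^-1 ^+ k.
Proof.
move=> uC.
have uc : cvg (u @ \oo).
  apply/cauchy_cvgP/cauchy_exP => e e0.
  have eE : e = ofr s (real_value e) by rewrite real_value_ge0 // ltW.
  have e'0 : 0 < real_value e by rewrite -(@ofr_lt R s) ofr0 -eE.
  have [k kC] := @geometric_small R C (real_value e / 2) (divr_gt0 e'0 (ltr0Sn _ 1)).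
  exists (u k), k => // l /= kl.
  rewrite -ball_normE /ball_ /= normE eE.
  have le : rnorm (u k - u l) < real_value e.
    rewrite rnormBC; apply: (le_lt_trans (uC _ _ kl)); apply: (le_lt_trans kC).
    by lra.
  by rewrite ofr_lt.
exists (lim (u @ \oo)) => k; apply/ler_addgt0Pr => e e0.
have e0' : 0 < ofr s e by rewrite -(@ofr0 R s) ofr_lt.
have [N _ hN] := (cvgrPdist_le _ _).1 uc _ e0'.
pose l := maxn N k.
have := hN l (leq_maxl _ _); rewrite /= rnorm_le => h1.
have := uC k l (leq_maxr _ _) => h2.
have -> : lim (u @ \oo) - u k = (u l - u k) + (lim (u @ \oo) - u l).
  by rewrite [RHS]addrC subrKA.
by apply: (le_trans (rnormD _ _)); exact: lerD.
Qed.

(** A uniform boundedness principle for a class [Lin] of maps bounded by the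
    weight [W], tested on the blocks of points [pt m 0], ..., [pt m (d m - 1)]. The class
    is not organized as a Banach space: only partial sums of one series and its
    pointwise limit are used. *)
Section GlidingHump.
Context (R : realType) (s : scalar_kind).
Context (F : completeNormedModType (scalars R s)) (D : Type) (W : D -> R).
Context (Lin : set (D -> F)).
Context (Lin0 : Lin (fun=> 0)).
Context (LinD : forall S T c, Lin S -> Lin T ->
  Lin (fun x => S x + ofr s c *: T x)).
Context (d : nat -> nat) (pt : nat -> nat -> D) (r : nat -> R).
Context (T0 : nat -> D -> F).
Context (r0 : forall m, 0 < r m).
Context (T0L : forall m, Lin (T0 m)).
Context (T0W : forall m x, rnorm (T0 m x) <= W x).

Definition block_sum m (S : D -> F) : R := \sum_(j < d m) rnorm (S (pt m j)).

Context (T0r : forall m, r m <= block_sum m (T0 m)).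

Definition unit_ball : set (D -> F) :=
  [set S | Lin S /\ forall x, rnorm (S x) <= W x].

(** The norm of the seminorm [block_sum m] on [Lin] relative to the weight [W]. *)
Definition block_norm m : R := sup [set block_sum m S | S in unit_ball].

Lemma block_has_sup m : has_sup [set block_sum m S | S in unit_ball].
Proof.
split; first by exists (block_sum m (T0 m)), (T0 m).
exists (\sum_(j < d m) W (pt m j)) => _ [S [_ SW] <-].
by apply: ler_sum => j _; exact: SW.
Qed.

Lemma block_norm_ge m : r m <= block_norm m.
Proof.
apply: (le_trans (T0r m)); apply: sup_upper_bound; first exact: block_has_sup.
by exists (T0 m).
Qed.

Lemma LinZ c S : Lin S -> Lin (fun x => ofr s c *: S x).
Proof.
move=> LS; have := LinD c Lin0 LS.
by congr Lin; apply/funext => x; rewrite add0r.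
Qed.

Lemma block_sum_le m S t : 0 < t -> Lin S ->
  (forall x, rnorm (S x) <= t * W x) -> block_sum m S <= t * block_norm m.
Proof.
move=> t0 LS SW; rewrite -ler_pdivrMl //.
have -> : t^-1 * block_sum m S = block_sum m (fun x => ofr s t^-1 *: S x).
  rewrite /block_sum mulr_sumr; apply: eq_bigr => j _.
  by rewrite rnormZr gtr0_norm // invr_gt0.
apply: sup_upper_bound; first exact: block_has_sup.
exists (fun x => ofr s t^-1 *: S x) => //; split; first exact: LinZ.
by move=> x; rewrite rnormZr gtr0_norm ?invr_gt0 // ler_pdivrMl.
Qed.

Lemma block_sum_triangle m (S T : D -> F) :
  block_sum m S <= block_sum m T + block_sum m (fun x => S x - T x).
Proof.
rewrite /block_sum -big_split; apply: ler_sum => j _ /=.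
by rewrite -[X in rnorm X <= _](subrK (T (pt m j))) addrC rnormD.
Qed.

(** The two sums for e = c and e = -c add up to at least twice the left side,
    because their terms differ by 2 c T. *)
Lemma good_sign m (S T : D -> F) (c : R) : 0 <= c ->
  exists2 e : R, `|e| = c &
    c * block_sum m T <= block_sum m (fun x => S x + ofr s e *: T x).
Proof.
move=> c0.
have H : 2 * (c * block_sum m T) <=
    block_sum m (fun x => S x + ofr s c *: T x) +
    block_sum m (fun x => S x + ofr s (- c) *: T x).
  rewrite /block_sum -big_split !mulr_sumr; apply: ler_sum => j _ /=.
  set x := pt m j; have -> : 2 * (c * rnorm (T x)) =
      rnorm (ofr s c *: T x + ofr s c *: T x).
    by rewrite -scalerDl -ofrD rnormZr ger0_norm ?addr_ge0 //; ring.
  have -> : ofr s c *: T x + ofr s c *: T x =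
      (S x + ofr s c *: T x) - (S x + ofr s (- c) *: T x).
    by rewrite opprD addrACA subrr add0r ofrN scaleNr opprK.
  by apply: (le_trans (rnormD _ _)); rewrite rnormN.
have [h|h] := leP (c * block_sum m T)
    (block_sum m (fun x => S x + ofr s c *: T x)).
  by exists c; rewrite ?ger0_norm.
exists (- c); first by rewrite normrN ger0_norm.
by lra.
Qed.

(** In block [m] take a unit vector [T' m] that reaches half of [block_norm m],
    and let T be the sum of e_m [T' m] where |e_m| = 4^-m, each sign being chosen
    by [good_sign] against the partial sum before it. The partial sum then has block
    sum at least (1/2) 4^-m [block_norm m], and all later terms together take away
    at most (1/3) 4^-m [block_norm m]. Near-optimality of [T' m] is what makes these
    two quantities comparable without any condition linking different blocks. *)
Lemma gliding_hump : exists (T : D -> F) (S : nat -> D -> F),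
  [/\ forall k, Lin (S k), forall x, S 0%N x = 0,
      forall k x, rnorm (T x - S k x) <= 4 / 3 * W x * 4^-1 ^+ k
    & forall m, r m / 6 * 4^-1 ^+ m <= block_sum m T].
Proof.
have q0 m : (0 : R) < 4^-1 ^+ m by rewrite exprn_gt0.
have K0 m : 0 < block_norm m by exact: lt_le_trans (block_norm_ge m).
have W0 x : 0 <= W x by exact: le_trans (rnorm_ge0 _) (T0W 0%N x).
have /choice [T' T'P] : forall m, exists S,
    unit_ball S /\ block_norm m / 2 <= block_sum m S.
  move=> m; have e0 : 0 < block_norm m / 2 by rewrite divr_gt0.
  have [_ [S US <-] h] := sup_adherent e0 (block_has_sup m).
  exists S; split=> //; move: h; rewrite -/(block_norm m); lra.
have /choice [e eP] : forall p : nat * (D -> F), exists e : R,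
    `|e| = 4^-1 ^+ p.1 /\
    4^-1 ^+ p.1 * block_sum p.1 (T' p.1) <=
      block_sum p.1 (fun x => p.2 x + ofr s e *: T' p.1 x).
  move=> [m S]; have [e e1 e2] := good_sign m S (T' m) (ltW (q0 m)).
  by exists e.
pose S := fix S n : D -> F := if n is m.+1 then
  fun x => S m x + ofr s (e (m, S m)) *: T' m x else fun=> 0.
have SL n : Lin (S n).
  by elim: n => [|n IH] //=; apply: LinD => //; have [[]] := T'P n.
have SS n k x : rnorm (S (k + n)%N x - S k x) <=
    4 / 3 * W x * (4^-1 ^+ k - 4^-1 ^+ (k + n)).
  elim: n => [|n IH]; first by rewrite addn0 !subrr rnorm0 mulr0.
  rewrite addnS /= addrAC; apply: (le_trans (rnormD _ _)).
  rewrite rnormZr; have [-> _] := eP ((k + n)%N, S (k + n)%N).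
  have [[_ TW] _] := T'P (k + n)%N.
  have := ler_wpM2l (ltW (q0 (k + n)%N)) (TW x); move: IH.
  by rewrite /= exprS; lra.
have Scauchy k l x : (k <= l)%N ->
    rnorm (S l x - S k x) <= 4 / 3 * W x * 4^-1 ^+ k.
  move=> kl; rewrite -{1}(subnKC kl); apply: (le_trans (SS _ _ _)).
  by rewrite ler_wpM2l ?mulr_ge0 // gerBl ltW.
have /choice [T TS] : forall x, exists v, forall k,
    rnorm (v - S k x) <= 4 / 3 * W x * 4^-1 ^+ k.
  by move=> x; apply: geometric_limit => k l; exact: Scauchy.
exists T, S; split=> // m.
have Sm l : (m < l)%N -> block_norm m / 6 * 4^-1 ^+ m <= block_sum m (S l).
  move=> ml.
  have h1 : 4^-1 ^+ m * (block_norm m / 2) <= block_sum m (S m.+1).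
    have [_ h] := eP (m, S m); apply: le_trans h => /=.
    by rewrite ler_pM2l //; have [] := T'P m.
  have h2 := block_sum_triangle m (S m.+1) (S l).
  have h3 : block_sum m (fun x => S m.+1 x - S l x) <=
      4^-1 ^+ m / 3 * block_norm m.
    apply: block_sum_le; first by rewrite divr_gt0.
      have := LinD (-1) (SL m.+1) (SL l); congr Lin; apply/funext => x.
      by rewrite ofrN ofr1 scaleN1r.
    move=> x; rewrite rnormBC; apply: (le_trans (Scauchy _ _ _ ml)).
    by rewrite exprS; have := W0 x; have := q0 m; nra.
  lra.
apply: (@le_trans _ _ (block_norm m / 6 * 4^-1 ^+ m)).
  by rewrite ler_pM2r // ler_pM2r ?invr_gt0 //; exact: block_norm_ge.
apply/ler_addgt0Pr => eps eps0.
have [k kP] := geometric_small (\sum_(j < d m) 4 / 3 * W (pt m j)) eps0.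
pose l := maxn m.+1 k.
apply: (le_trans (Sm l (leq_maxl _ _))).
apply: (le_trans (block_sum_triangle m _ T)); rewrite lerD2l.
apply: le_trans kP; rewrite /block_sum mulr_suml; apply: ler_sum => j _.
rewrite rnormBC; apply: (le_trans (TS _ _)).
rewrite ler_wpM2l ?mulr_ge0 //.
by rewrite ler_wiXn2l ?leq_maxr // ?invr_ge0 ?invf_le1 ?ler1n.
Qed.

End GlidingHump.

(** * Sequences and concatenation of blocks *)

Section Sequences.
Context (R : realType) (s : scalar_kind) (E : normedModType (scalars R s)).
Implicit Types (x : nat -> E) (p : R).

Lemma lp_seq_bounded x p (C : R) :
  (forall n, \sum_(t < n) rnorm (x t) `^ p <= C) -> lp_seq p x.
Proof.
move=> xC; rewrite /lp_seq /=; apply: (@le_lt_trans _ _ C%:E); last exact: ltry.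
apply: lime_le.
  by apply: is_cvg_nneseries => n _ _; rewrite lee_fin powR_ge0.
by apply: nearW => n; rewrite sumEFin lee_fin big_mkord.
Qed.

Lemma lp_seq_sum_le x p : lp_seq p x ->
  exists C : R, forall n, \sum_(t < n) rnorm (x t) `^ p <= C.
Proof.
rewrite /lp_seq /= => xp.
set S := (\sum_(0 <= j <oo) _)%E in xp.
have S0 : (0 <= S)%E.
  by apply: nneseries_ge0 => n _ _; rewrite lee_fin powR_ge0.
exists (fine S) => n; rewrite -lee_fin fineK ?ge0_fin_numE //.
rewrite -(big_mkord xpredT (fun t => rnorm (x t) `^ p)) -sumEFin.
by apply: nneseries_lim_ge => t _ _; rewrite lee_fin powR_ge0.
Qed.

End Sequences.

(** Sums of squares are at most the square of the sum. *)
Lemma weak_lp_of_weak_l1 (R : realType) (s : scalar_kind)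
    (E : normedModType (scalars R s)) (x : nat -> E) (q : R) : q = 1 \/ q = 2 ->
  (forall (phi : E -> scalars R s) M, 0 <= M -> bounded_functional phi M ->
     exists C : R, forall n, \sum_(t < n) rabs (phi (x t)) <= C) ->
  weak_lp_seq q x.
Proof.
move=> q12 xC phi [M phiM].
have [||C hC] := xC phi (rabs M); first exact: rabs_ge0.
  split=> [a u v|y]; first exact: linearP.
  have M0 : 0 <= M * `|y| by exact: le_trans (normr_ge0 _) (phiM y).
  rewrite -(@ofr_le R s) ofrM -!rabsE -normE.
  by apply: (le_trans (phiM y)); rewrite -(ger0_norm M0) normrM normr_id.
case: q12 => ->.
  apply: (lp_seq_bounded (C := C)) => n.
  by under eq_bigr do rewrite powRr1 ?rnorm_ge0 //; exact: hC.
apply: (lp_seq_bounded (C := C ^+ 2)) => n.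
under eq_bigr do rewrite (powR_mulrn 2) ?rnorm_ge0 //.
have S0 : 0 <= \sum_(t < n) rabs (phi (x t)).
  by rewrite sumr_ge0 // => t _; exact: rabs_ge0.
apply: (@le_trans _ _ ((\sum_(t < n) rabs (phi (x t))) ^+ 2)); last first.
  by rewrite ler_pXn2r ?nnegrE ?hC //; exact: le_trans S0 (hC n).
rewrite [leRHS]expr2 mulr_suml; apply: ler_sum => t _.
rewrite expr2 ler_wpM2l ?rabs_ge0 // (bigD1 t) //= lerDl.
by rewrite sumr_ge0 // => j _; exact: rabs_ge0.
Qed.

Section Concatenation.
Context (d : nat -> nat).

Definition offset (m : nat) : nat := (\sum_(l < m) d l)%N.

Lemma offsetS m : offset m.+1 = (offset m + d m)%N.
Proof. by rewrite /offset big_ord_recr. Qed.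

Lemma offset_le m n : (m <= n)%N -> (offset m <= offset n)%N.
Proof.
move=> /subnKC <-; elim: (n - m)%N => [|k IH]; first by rewrite addn0.
by rewrite addnS offsetS (leq_trans IH) // leq_addr.
Qed.

Lemma leq_offset (d0 : forall m, (0 < d m)%N) m : (m <= offset m)%N.
Proof.
by elim: m => // m IH; rewrite offsetS -addn1 leq_add.
Qed.

(** Blocks of sizes [d 0], [d 1], ... placed one after the other fill the natural
    numbers without overlap. *)
Lemma concatenation (T : Type) (X : nat -> nat -> T) :
  exists x : nat -> T, forall m j, (j < d m)%N -> x (offset m + j)%N = X m j.
Proof.
suff /choice [x xP] : forall t, exists v, forall m j, (j < d m)%N ->
    (offset m + j)%N = t -> v = X m j.
  by exists x => m j jd; exact: xP.
move=> t; have [[m [j [jd <-]]]|no] := pselect (exists m j,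
    (j < d m)%N /\ (offset m + j)%N = t); last first.
  by exists (X 0%N 0%N) => m j jd jt; case: no; exists m, j.
exists (X m j) => m' j' jd' e.
have lt_neq a b i k : (a < b)%N -> (i < d a)%N ->
    (offset a + i)%N <> (offset b + k)%N.
  move=> ab ia e'; have := offset_le ab; rewrite offsetS; lia.
have [mm|mm|mm] := ltngtP m m'.
- by case: (lt_neq _ _ _ j' mm jd).
- by case: (lt_neq _ _ _ j mm jd').
- by move: e; rewrite mm => /addnI ->.
Qed.

Lemma concatenation_sum (V : nmodType) (h : nat -> V) M :
  \sum_(t < offset M) h t = \sum_(m < M) \sum_(j < d m) h (offset m + j)%N.
Proof.
elim: M => [|M IH]; first by rewrite /offset !big_ord0.
by rewrite offsetS big_split_ord big_ord_recr /= -IH.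
Qed.

End Concatenation.

Lemma geometric_sum_le (R : realType) (n : nat) :
  \sum_(m < n) 2^-1 ^+ m <= 2 :> R.
Proof.
have -> : \sum_(m < n) 2^-1 ^+ m = 2 - 2 * 2^-1 ^+ n :> R.
  elim: n => [|n IH]; first by rewrite big_ord0 expr0; lra.
  by rewrite big_ord_recr /= IH exprS; lra.
by rewrite gerBl mulr_ge0 // exprn_ge0.
Qed.

(** * Diagonal multilinear maps *)

Section Multilinear.
Context (R : realType) (s : scalar_kind) (I : finType).
Local Notation K := (scalars R s).
Context (X : I -> completeNormedModType K) (F : completeNormedModType K).
Local Notation D := (forall i, X i).

Lemma multilinear0 : multilinear (fun _ : D => 0 : F).
Proof. by move=> i x a u v; rewrite scaler0 addr0. Qed.

Lemma multilinearD (S T : D -> F) (c : R) : multilinear S -> multilinear T ->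
  multilinear (fun x => S x + ofr s c *: T x).
Proof.
move=> hS hT i x a u v; rewrite hS hT !scalerDr !scalerA [_ * a]mulrC.
by rewrite addrACA.
Qed.

Definition prod_norm (x : D) : R := \prod_i rnorm (x i).

Lemma multilinear_limit (T : D -> F) (S : nat -> D -> F) (C : R) :
  (forall k, multilinear (S k)) ->
  (forall k x, rnorm (T x - S k x) <= C * prod_norm x * 4^-1 ^+ k) ->
  multilinear T.
Proof.
move=> SL TS i x a u v; apply/eqP; rewrite -subr_eq0; apply/eqP.
apply: rnorm_eq0; apply/eqP; rewrite eq_le rnorm_ge0 andbT.
apply/ler_addgt0Pr => e e0; rewrite add0r.
pose w := dfwith x i.
pose B := C * prod_norm (w (a *: u + v)) + rabs a * (C * prod_norm (w u)) +
  C * prod_norm (w v).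
have [k kP] := geometric_small B e0; apply: le_trans kP.
have -> : T (w (a *: u + v)) - (a *: T (w u) + T (w v)) =
    (T (w (a *: u + v)) - S k (w (a *: u + v))) -
    a *: (T (w u) - S k (w u)) - (T (w v) - S k (w v)).
  rewrite (SL k) scalerBr !opprB -[RHS]addrA.
  by rewrite [X in _ = _ + X]addrACA [RHS]subrKA -opprD.
apply: (le_trans (rnormD _ _)); rewrite rnormN /B mulrDl.
apply: lerD; last exact: TS.
apply: (le_trans (rnormD _ _)); rewrite rnormN mulrDl rnormZ.
apply: lerD; first exact: TS.
by rewrite -mulrA ler_wpM2l ?rabs_ge0 //; exact: TS.
Qed.

Lemma multilinear_prod (N : nat) (p : forall i, 'I_N -> X i -> K) (y : 'I_N -> F) :
  (forall i j, bounded_functional (p i j) 1) ->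
  multilinear (fun x : D => \sum_j (\prod_i p i j (x i)) *: y j).
Proof.
move=> pM i x a u v; rewrite scaler_sumr -big_split; apply: eq_bigr => j _ /=.
rewrite scalerA -scalerDl; congr (_ *: _).
have E w : \prod_l p l j (dfwith x i w l) =
    p i j w * \prod_(l | l != i) p l j (x l).
  rewrite (bigD1 i) //= dfwithin; congr (_ * _); apply: eq_bigr => l li.
  by rewrite dfwithout // eq_sym.
by rewrite !E (pM i j).1 mulrDl mulrA.
Qed.

(** The coefficients are bounded by [prod_norm x], so the unconditionality of
    [y] bounds the sum, whatever the number of variables. *)
Lemma prod_bound (N : nat) (p : forall i, 'I_N -> X i -> K) (y : 'I_N -> F) :
  (forall i j, bounded_functional (p i j) 1) ->
  (forall (a : 'I_N -> K) t, 0 <= t ->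
       (forall j, rabs (a j) <= t) -> rnorm (\sum_j a j *: y j) <= t) ->
  forall x : D, rnorm (\sum_j (\prod_i p i j (x i)) *: y j) <= prod_norm x.
Proof.
move=> pM yP x; apply: yP => [|j].
  by rewrite prodr_ge0 // => i _; exact: rnorm_ge0.
rewrite rabs_prod; apply: ler_prod => i _; rewrite rabs_ge0 /=.
by apply: (le_trans ((pM i j).2 _)); rewrite mul1r.
Qed.

End Multilinear.

(** The coefficients that rotate each [phi (x j)] onto its modulus have modulus at
    most 1. *)
Lemma cube_weak_sum (R : realType) (s : scalar_kind)
    (E : normedModType (scalars R s)) (N : nat) (x : 'I_N -> E) (L M : R)
    (phi : E -> scalars R s) :
  (forall a : 'I_N -> scalars R s, (forall j, rabs (a j) <= 1) ->
     rnorm (\sum_j a j *: x j) <= L) ->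
  0 <= M -> bounded_functional phi M -> \sum_j rabs (phi (x j)) <= M * L.
Proof.
move=> xL M0 phiM.
have /choice [a aP] : forall j, exists a, rabs a <= 1 /\
    a * phi (x j) = ofr s (rabs (phi (x j))).
  move=> j; have [->|z0] := eqVneq (phi (x j)) 0.
    by exists 0; rewrite rabs0 ofr0 mul0r.
  exists (ofr s (rabs (phi (x j))) / phi (x j)); rewrite divfK //; split=> //.
  rewrite -(@ofr_le R s) -rabsE ofr1 normrM normfV rabsE ofr_norm.
  by rewrite ger0_norm ?rabs_ge0 // -rabsE mulfV // normr_eq0.
have sumE : phi (\sum_j a j *: x j) = ofr s (\sum_j rabs (phi (x j))).
  rewrite (bfun_sum phiM) (big_morph (ofr s) (@ofrD R s) (@ofr0 R s)).
  by apply: eq_bigr => j _; rewrite (bfunZ phiM) (aP j).2.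
have : rabs (phi (\sum_j a j *: x j)) <= M * L.
  apply: (le_trans (phiM.2 _)); rewrite ler_wpM2l //.
  by apply: xL => j; exact: (aP j).1.
by rewrite sumE rabs_ofr; exact: le_trans (ler_norm _).
Qed.

Lemma extend_ord (T : Type) (N : nat) (f : 'I_N -> T) (t0 : T) :
  exists g : nat -> T, forall j : 'I_N, g j = f j.
Proof.
exists (fun j => if insub j is Some i then f i else t0) => j.
by rewrite insubT // => jN; congr f; exact: val_inj.
Qed.

(** For each [m] the diagonal map [T0 m] sends the [j]-th vectors of [d m]-dimensional
    cubes in the spaces [X i] to the [j]-th vector of an unconditional family of [F]
    whose norms have a huge sum. The gliding hump merges them into one [T]. The cube
    vectors of block [m] are scaled by 2^-m, which makes the concatenated sequences
    weakly summable; the sums in [F] lose the factor 2^(-m #|I|) and, in the gliding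
    hump, 6^-1 4^-m, which the choice of the family of [F] compensates: each
    block contributes at least 1. *)
Lemma non_summing_multilinear (R : realType) (s : scalar_kind) (I : finType)
    (i0 : I) (X : I -> completeNormedModType (scalars R s))
    (F : completeNormedModType (scalars R s)) :
  infinite_dimensional F -> (forall i, exists L, uniform_cubes (X i) L) ->
  exists T : (forall i, X i) -> F, bounded_multilinear X F T /\
    exists x : forall i, nat -> X i,
      (forall i q, q = 1 \/ q = 2 -> weak_lp_seq q (x i)) /\
      ~ lp_seq 1 (fun t => T (fun i => x i t)).
Proof.
move=> Finf cubes; pose be m : R := 2^-1 ^+ m.
have be0 m : 0 < be m by rewrite exprn_gt0.
pose bc m := be m ^+ #|I|.
have bc0 m : 0 < bc m by rewrite exprn_gt0.
pose r m : R := 6 * 4 ^+ m.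
have r0 m : 0 < r m by rewrite mulr_gt0 // exprn_gt0.
have /choice [d /choice [y yP]] : forall m, exists (N : nat) (y : nat -> F),
    (forall (a : 'I_N -> scalars R s) t, 0 <= t ->
       (forall j, rabs (a j) <= t) -> rnorm (\sum_j a j *: y j) <= t) /\
    r m / bc m <= \sum_(j < N) rnorm (y j).
  move=> m; have [N [y [y1 y2]]] := large_unconditional_family Finf (r m / bc m).
  have [z zE] := extend_ord y 0; exists N, z; split.
    by move=> a t t0 at_; under eq_bigr do rewrite zE; exact: y1.
  by under eq_bigr do rewrite zE.
have d0 m : (0 < d m)%N.
  rewrite lt0n; apply/eqP => dm; have [_] := yP m; rewrite dm big_ord0.
  by apply/negP; rewrite -ltNge divr_gt0.
have cubes' i : exists L, forall m,
    exists (x : nat -> X i) (p : nat -> X i -> scalars R s),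
    [/\ forall j : 'I_(d m), bounded_functional (p j) 1,
        forall j l : 'I_(d m), p j (x l) = (j == l)%:R
      & forall a : 'I_(d m) -> scalars R s, (forall j, rabs (a j) <= 1) ->
          rnorm (\sum_j a j *: x j) <= L].
  have [L hL] := cubes i; exists L => m.
  have [x [p [h1 h2 h3]]] := hL (d m).
  have [x' xE] := extend_ord x 0; have [p' pE] := extend_ord p (fun=> 0).
  exists x', p'; split=> [j|j l|a a1]; rewrite ?xE ?pE //.
  by under eq_bigr do rewrite xE; exact: h3.
have [L hL] : exists L : I -> R, forall i m, exists
    (x : nat -> X i) (p : nat -> X i -> scalars R s),
    [/\ forall j : 'I_(d m), bounded_functional (p j) 1,
        forall j l : 'I_(d m), p j (x l) = (j == l)%:R
      & forall a : 'I_(d m) -> scalars R s, (forall j, rabs (a j) <= 1) ->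
          rnorm (\sum_j a j *: x j) <= L i].
  by exists (fun i => sval (cid (cubes' i))) => i; exact: svalP (cid (cubes' i)).
pose e i m := sval (cid (hL i m)).
pose p i m := sval (cid (svalP (cid (hL i m)))).
have hp i m : [/\ forall j : 'I_(d m), bounded_functional (p i m j) 1,
        forall j l : 'I_(d m), p i m j (e i m l) = (j == l)%:R
      & forall a : 'I_(d m) -> scalars R s, (forall j, rabs (a j) <= 1) ->
          rnorm (\sum_j a j *: e i m j) <= L i].
  exact: svalP (cid (svalP (cid (hL i m)))).
pose pt m j : forall i, X i := fun i => ofr s (be m) *: e i m j.
pose T0 m (x : forall i, X i) :=
  \sum_(j < d m) (\prod_i p i m j (x i)) *: y m j.
have pM m i (j : 'I_(d m)) : bounded_functional (p i m j) 1.
  by have [+ _ _] := hp i m; apply.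
have T0pt m (j : 'I_(d m)) : T0 m (pt m j) = ofr s (bc m) *: y m j.
  rewrite /T0 (bigD1 j) //= [X in _ + X]big1 ?addr0 => [|l lj].
    congr (_ *: _); rewrite /bc -[#|I|]/(#|xpredT : pred I|) -prodr_const.
    rewrite (big_morph (ofr s) (@ofrM R s) (@ofr1 R s)); apply: eq_bigr => i _.
    rewrite /pt (bfunZ (pM m i j)); have [_ -> _] := hp i m.
    by rewrite eqxx mulr1.
  rewrite (bigD1 i0) //= /pt (bfunZ (pM m i0 l)); have [_ -> _] := hp i0 m.
  by rewrite (negbTE lj) mulr0 mul0r scale0r.
have T0r m : r m <= block_sum d pt m (T0 m).
  rewrite /block_sum; under eq_bigr do rewrite T0pt rnormZr gtr0_norm //.
  rewrite -mulr_sumr -ler_pdivrMl // mulrC.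
  by have [] := yP m.
have [T [S [SL S0 TS Tr]]] := @gliding_hump R s F _ (@prod_norm R s I X)
  (@multilinear _ I X F) (@multilinear0 R s I X F)
  (@multilinearD R s I X F) d pt r T0 r0
  (fun m => multilinear_prod (fun j => y m j) (fun i (j : 'I_(d m)) => pM m i j))
  (fun m => prod_bound (fun i (j : 'I_(d m)) => pM m i j) (yP m).1) T0r.
exists T; split.
  split; first exact: (multilinear_limit SL TS).
  exists (ofr s (4 / 3)) => x.
  have := TS 0%N x; rewrite S0 subr0 expr0 mulr1 => h.
  rewrite normE (eq_bigr (fun i => ofr s (rnorm (x i)))); last first.
    by move=> i _; rewrite normE.
  by rewrite -(big_morph (ofr s) (@ofrM R s) (@ofr1 R s)) -ofrM ofr_le.
have hc i := concatenation d (fun m j => pt m j i).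
pose x i := sval (cid (hc i)).
have xE i m j : (j < d m)%N -> x i (offset d m + j)%N = pt m j i.
  exact: (svalP (cid (hc i))).
exists x; split=> [i q q12|].
  apply: weak_lp_of_weak_l1 => // phi M M0 phiM.
  exists (2 * (M * L i)) => n.
  have L0 : 0 <= L i.
    have [_ _ h] := hp i 0%N; apply: le_trans (h (fun=> 0) _); first exact: rnorm_ge0.
    by move=> j; rewrite rabs0.
  apply: (@le_trans _ _ (\sum_(t < offset d n) rabs (phi (x i t)))).
    rewrite -!(big_mkord xpredT (fun t => rabs (phi (x i t)))).
    rewrite [leRHS](big_cat_nat _ (leq_offset d0 n)) //= lerDl.
    by rewrite sumr_ge0 // => t _; exact: rabs_ge0.
  rewrite (concatenation_sum d (fun t => rabs (phi (x i t)))).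
  apply: (@le_trans _ _ (\sum_(m < n) be m * (M * L i))); last first.
    by rewrite -mulr_suml ler_wpM2r ?geometric_sum_le // mulr_ge0.
  apply: ler_sum => m _.
  under eq_bigr => j _ do rewrite xE // /pt (bfunZ phiM) rabsM rabs_ofr gtr0_norm //.
  rewrite -mulr_sumr ler_pM2l //; have [_ _ h] := hp i m.
  exact: (cube_weak_sum h M0 phiM).
move=> /lp_seq_sum_le [C hC].
have := hC (offset d (Num.bound `|C|)).
under eq_bigr do rewrite powRr1 ?rnorm_ge0 //.
rewrite (concatenation_sum d (fun t => rnorm (T (fun i => x i t)))).
apply/negP; rewrite -ltNge.
have Cb : C < (Num.bound `|C|)%:R.
  apply: (le_lt_trans (ler_norm _)).
  by have := archi_boundP (_ : 0 <= `|C|); apply.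
apply: (lt_le_trans Cb).
have -> : (Num.bound `|C|)%:R = \sum_(m < Num.bound `|C|) (1 : R).
  by rewrite sumr_const card_ord.
apply: ler_sum => m _.
have -> : \sum_(j < d m) rnorm (T (fun i => x i (offset d m + j)%N)) =
    block_sum d pt m T.
  apply: eq_bigr => j _; congr (rnorm (T _)).
  by apply: functional_extensionality_dep => i; rewrite xE.
apply: le_trans (Tr m); rewrite /r exprVn.
by rewrite -[6 * _ / 6]mulrAC mulfV ?pnatr_eq0 // mul1r mulfV.
Qed.

Lemma join_family_cases (B : Type) (P : B -> Prop) (n k : nat) (hkn : (k <= n)%N)
    (E : 'I_k -> B) (G : 'I_(n - k) -> B) :
  (forall i, P (E i)) -> (forall i, P (G i)) ->
  forall i, P (join_family hkn E G i).
Proof. by move=> PE PG i; rewrite /join_family; case: fintype.split. Qed.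

Theorem mainTheorem6 (R : realType) (s : scalar_kind) (n k : nat)
    (hk : (1 <= k)%N) (hkn : (k <= n)%N)
    (E : 'I_k -> completeNormedModType (scalars R s))
    (Einf : forall i, infinite_dimensional (E i))
    (ELinfty : forall i, script_Linfty_space (E i)) :
  ~ exists F : completeNormedModType (scalars R s),
      infinite_dimensional F /\
      forall G : 'I_(n - k) -> completeNormedModType (scalars R s),
        bounded_multilinear (join_family hkn E G) F =
        abs_summing 1 (fun i : 'I_n => if (i < k)%N then 2 else 1)
          (join_family hkn E G) F.
Proof.
(* Infinite-dimensional L_oo-spaces are enough for the free spaces. *)
move=> [F [Finf FG]]; pose G (i : 'I_(n - k)) := E (Ordinal hk).
have cubesE i : exists L, uniform_cubes (E i) L.
  exact: script_Linfty_cubes.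
have cubes := join_family_cases hkn (G := G)
  (P := fun B : completeNormedModType (scalars R s) =>
          exists L, uniform_cubes B L) cubesE (fun=> cubesE _).
have [T [TM [x [xw xT]]]] :=
  non_summing_multilinear (Ordinal (leq_trans hk hkn)) Finf cubes.
move: TM; rewrite FG => -[_ Tsum]; apply: xT; apply: Tsum => i.
by apply: xw; case: ifP; [right | left].
Qed.
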